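(* There is an algorithm that, given as input a vertex-facet incidence matrix of a polytope $P$ and an integer $k\ge 0$, computes the Hasse diagram of the $k$-skeleton of $P$ in time $$O(n\cdot\alpha\cdot\varphi^{\le k}),$$ where $n$ is the number of vertices of $P$, $\alpha$ is the number of vertex-facet incidences of $P$, and $\varphi^{\le k}$ is the number of faces of $P$ of dimension at most $k$.
   Context: A polytope $P$ is a bounded convex polyhedron; its faces include $\varnothing$ (of dimension $-1$) and $P$ itself. A vertex-facet incidence matrix of $P$ is a matrix $A=(a_{fv})\in\{0,1\}^{m\times n}$, with rows indexed by the $m$ facets and columns by the $n$ vertices of $P$, such that $a_{fv}=1$ if facet $f$ contains vertex $v$ and $a_{fv}=0$ otherwise; $\alpha$ is the number of ones in $A$. The $k$-skeleton of $P$ is the set of all faces of $P$ of dimension at most $k$, ordered by inclusion. Its Hasse diagram is the (unlabeled, abstract) directed graph whose nodes correspond to the faces of dimension at most $k$, with an arc from the node of $H$ to the node of $G$ if and only if $H\subsetneq G$ and $\dim G=\dim H+1$. Running times refer to the uniform time measure (every arithmetic operation or comparison takes one unit of time). The constants in the $O$-notation are absolute, and $O(f)$ means at most a constant times $\max\{1,f\}$. *)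

(* Defs.v *)
From mathcomp Require Import all_boot all_order all_algebra finmap.
From mathcomp Require Import boolp classical_sets functions cardinality reals.

Set Implicit Arguments.
Unset Strict Implicit.
Unset Printing Implicit Defensive.

Import Order.TTheory GRing.Theory Num.Theory.

(** * Polytopes and their faces *)

Section Polytopes.
Local Open Scope classical_set_scope.
Local Open Scope ring_scope.

Variables (R : realType) (d : nat).
Implicit Types (P F G : set 'cV[R]_d).

Definition polyhedron P : Prop :=
  exists (q : nat) (A : 'M[R]_(q, d)) (b : 'cV[R]_q),
    P = [set x | forall i, (A *m x) i 0 <= b i 0].

(* Boundedness is stated coordinatewise because the normed structure on
   matrices is not available when d = 0. *)
Definition bounded P : Prop :=
  exists M : R, forall x, P x -> forall i, `|x i 0| <= M.

(* The empty set and single points are polytopes. *)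
Definition polytope P : Prop := polyhedron P /\ bounded P.

(* c is arbitrary: c = 0 with delta = 0, resp. delta = 1, makes P itself,
   resp. the empty set, a face. *)
Definition face P F : Prop :=
  exists (c : 'rV[R]_d) (delta : R),
    (forall x, P x -> (c *m x) 0 0 <= delta) /\
    F = P `&` [set x | (c *m x) 0 0 = delta].

(* F contains r affinely independent points, the columns of X: the only
   coefficients with sum 0 and X-combination 0 are 0. *)
Definition has_affine_indep F (r : nat) : Prop :=
  exists X : 'M[R]_(d, r),
    (forall j, F (col j X)) /\
    (forall lambda : 'cV[R]_r,
       \sum_j lambda j 0 = 0 -> X *m lambda = 0 -> lambda = 0).

(* Dimension of the affine hull; at most d + 1 points of 'cV_d are affinely
   independent, so the range of r is exhaustive. affdim set0 = -1. *)
Definition affdim F : int :=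
  (\max_(r < d.+2 | `[< has_affine_indep F r >]) r)%:Z - 1.

Definition vertex P F : Prop := face P F /\ affdim F = 0.

(* The facet of a single point is the empty face, of dimension -1. *)
Definition facet P F : Prop := face P F /\ affdim F = affdim P - 1.

Definition incidence_matrix P (m n : nat) (A : 'M[bool]_(m, n)) : Prop :=
  exists (fct : 'I_m -> set 'cV[R]_d) (vtx : 'I_n -> set 'cV[R]_d),
    [/\ injective fct, (forall F, facet P F <-> exists i, F = fct i),
        injective vtx, (forall F, vertex P F <-> exists j, F = vtx j)
      & forall i j, A i j <-> vtx j `<=` fct i].

Definition skeleton P (k : nat) : set (set 'cV[R]_d) :=
  [set F | face P F /\ affdim F <= k%:Z].

(* The skeleton of a polytope is finite; fset_set of an infinite set is empty,
   which is irrelevant here. *)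
Definition num_faces P (k : nat) : nat := #|` fset_set (skeleton P k)|.

(* (N, arcs) is an explicit list representation, without repetitions, of the
   Hasse diagram of the k-skeleton, with node set {0, ..., N-1}; the numbering
   of the faces is arbitrary since the diagram is unlabeled. *)
Definition hasse_diagram P (k : nat) (N : nat) (arcs : seq (nat * nat)) : Prop :=
  exists phi : 'I_N -> set 'cV[R]_d,
    [/\ injective phi, (forall F, skeleton P k F <-> exists i, F = phi i),
        uniq arcs, (forall a, a \in arcs -> (a.1 < N)%N /\ (a.2 < N)%N)
      & forall i j : 'I_N,
          (nat_of_ord i, nat_of_ord j) \in arcs <->
          phi i `<` phi j /\ affdim (phi j) = affdim (phi i) + 1].

End Polytopes.

Definition num_incidences (m n : nat) (A : 'M[bool]_(m, n)) : nat :=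
  #|[set fv : 'I_m * 'I_n | A fv.1 fv.2]|.

(** * Random access machine with the uniform time measure

  Memory holds natural numbers, in scalar variables and in unbounded arrays;
  a program mentions finitely many of each. Control flow is structured.
  Multiplication is left out on purpose: at unit cost on unbounded integers it
  would be unreasonably powerful. *)

Record state := State { var : nat -> nat ; arr : nat -> nat -> nat }.

Inductive binop := Plus | Minus | Leq | Lt | Eq.

Definition eval_op (o : binop) (x y : nat) : nat :=
  match o with
  | Plus => x + y
  | Minus => x - y
  | Leq => x <= y
  | Lt => x < y
  | Eq => x == y
  end.

Inductive expr :=
| Const of nat
| Var of nat
| Get of nat & expr
| Bin of binop & expr & expr.

Fixpoint eval (s : state) (e : expr) : nat :=
  match e with
  | Const c => c
  | Var x => var s x
  | Get a e1 => arr s a (eval s e1)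
  | Bin o e1 e2 => eval_op o (eval s e1) (eval s e2)
  end.

Fixpoint cost (e : expr) : nat :=
  match e with
  | Const _ | Var _ => 1
  | Get _ e1 => (cost e1).+1
  | Bin _ e1 e2 => (cost e1 + cost e2).+1
  end.

Inductive prog :=
| Skip
| Assign of nat & expr
| Store of nat & expr & expr
| Seq of prog & prog
| If of expr & prog & prog
| While of expr & prog.

Definition set_var (s : state) (x v : nat) : state :=
  State (fun y => if y == x then v else var s y) (arr s).

Definition set_arr (s : state) (a i v : nat) : state :=
  State (var s)
    (fun b j => if (b == a) && (j == i) then v else arr s b j).

(* exec p s t s': started in s, p halts in s' after t units of time. *)
Inductive exec : prog -> state -> nat -> state -> Prop :=
| ExecSkip s : exec Skip s 1 s
| ExecAssign s x e : exec (Assign x e) s (cost e).+1 (set_var s x (eval s e))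
| ExecStore s a e1 e2 :
    exec (Store a e1 e2) s (cost e1 + cost e2).+1
         (set_arr s a (eval s e1) (eval s e2))
| ExecSeq s s1 s2 p q t1 t2 :
    exec p s t1 s1 -> exec q s1 t2 s2 -> exec (Seq p q) s (t1 + t2) s2
| ExecIfTrue s s1 e p q t :
    eval s e != 0 -> exec p s t s1 -> exec (If e p q) s (cost e + t).+1 s1
| ExecIfFalse s s1 e p q t :
    eval s e = 0 -> exec q s t s1 -> exec (If e p q) s (cost e + t).+1 s1
| ExecWhileTrue s s1 s2 e p t1 t2 :
    eval s e != 0 -> exec p s t1 s1 -> exec (While e p) s1 t2 s2 ->
    exec (While e p) s (cost e + t1 + t2).+1 s2
| ExecWhileFalse s e p : eval s e = 0 -> exec (While e p) s (cost e).+1 s.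

Lemma exec_deterministic p s t1 s1 t2 s2 :
  exec p s t1 s1 -> exec p s t2 s2 -> t1 = t2 /\ s1 = s2.
Proof.
move=> H; elim: H t2 s2 => {p s t1 s1};
  intros;
  match goal with H : exec _ _ ?t ?s |- _ = ?t /\ _ = ?s =>
    inversion H; clear H; subst end;
  try by [];
  repeat match goal with
  | IH : forall t s, exec ?p ?s0 t s -> _, E : exec ?p ?s0 _ _ |- _ =>
      case: (IH _ _ E) => ? ?; subst; clear E
  | E : eval ?s ?e = 0, N : is_true (eval ?s ?e != 0) |- _ =>
      by rewrite E in N
  end;
  by [].
Qed.

(* Input: variables 0, 1, 2 hold m, n, k; array 0 holds A in row-major order;
   everything else is 0. *)
Definition input (m n : nat) (A : 'M[bool]_(m, n)) (k : nat) : state :=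
  State
    (fun x => nth 0 [:: m; n; k] x)
    (fun a i =>
       (a == 0) && [exists f : 'I_m, exists v : 'I_n, (i == f * n + v) && A f v]).

(* Output: variables 0 and 1 hold the numbers of nodes and arcs; arrays 0 and 1
   hold the tails and heads of the arcs. *)
Definition output_nodes (s : state) : nat := var s 0.

Definition output_arcs (s : state) : seq (nat * nat) :=
  [seq (arr s 0 e, arr s 1 e) | e <- iota 0 (var s 1)].

(* Main.v *)
(** A face is determined by its vertex set, and the vertex sets of faces are the
    sets closed under "every facet containing S contains v". For a closed set T
    and a vertex v outside T, the closure of T + v costs O(alpha) on a list of
    the incidences. It covers T iff for every vertex u in it and outside T the
    closure of T + u has the same cardinality; restricting to the least such v
    yields each cover once. So the covers of one face cost O(n alpha), and a
    search from the empty face that stops at dimension k finds the k-skeleton,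
    since the face lattice is graded.

    On the geometric side, a nonempty face of {x | M x <= b} is the set of
    points whose tight rows include those of one of its points, and its
    dimension is that of the kernel of these rows. That closed sets are faces,
    and that the lattice is graded, both follow from one fact: if a nonempty face F of G
    misses a point z of G, then a face of G of codimension one contains F and
    misses z. A face between F and G that misses z and has the fewest tight
    rows has codimension one, as otherwise one could rotate out of it. *)
Require Import Defs.
From mathcomp Require Import all_boot all_order all_algebra zify.

Set Implicit Arguments.
Unset Strict Implicit.
Unset Printing Implicit Defensive.

(** * Closed vertex sets *)

Section ClosureSystem.
Variables (m n : nat) (A : 'M[bool]_(m, n)).
Implicit Types S T U : {set 'I_n}.

(** Charging a closure to alpha requires m, n <= alpha. This holds once every facet has a vertex and
    every vertex lies on a facet, hence in dimension at least 1; the empty polytope and the single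
    point, where alpha is 0, are absorbed by the 1 in [maxn 1]. The incidences are extracted from
    the matrix once, at cost mn <= n alpha, so that no closure reads a zero entry. Closures are
    compared by cardinality only: comparing them as sets would cost n for each pair of vertices, n^3
    per face, too much already for a polygon, where alpha is 2n. Recognising a face found before
    must not add a factor either: a vertex set, read as an n-bit number, addresses an array that is
    initially zero, and its code takes only n doublings. No dimension is ever computed; ranks are
    propagated along covers. The combinatorial half knows the polytope only through [rank_function];
    the geometric half supplies such a rank. *)

Definition facet_closure S : {set 'I_n} :=
  [set v | [forall f, [forall w in S, A f w] ==> A f v]].

Definition facet_closed S := facet_closure S == S.

Lemma facet_closureP S v :
  reflect (forall f, (forall w, w \in S -> A f w) -> A f v) (v \in facet_closure S).
Proof.
rewrite inE; apply: (iffP forallP) => h f.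
  by move=> /forall_inP Sf; have := h f; rewrite Sf.
by apply/implyP => /forall_inP; exact: h.
Qed.

Lemma subset_facet_closure S : S \subset facet_closure S.
Proof. by apply/subsetP => v Sv; apply/facet_closureP => f; exact. Qed.

Lemma facet_closure_subset S T : S \subset T -> facet_closure S \subset facet_closure T.
Proof.
move=> /subsetP s; apply/subsetP => v /facet_closureP h; apply/facet_closureP => f hT.
by apply: h => w /s; exact: hT.
Qed.

Lemma closed_facet_closure S : facet_closed (facet_closure S).
Proof.
rewrite /facet_closed eqEsubset subset_facet_closure andbT.
apply/subsetP => v /facet_closureP h.
by apply/facet_closureP => f hf; apply: h => w /facet_closureP; exact.
Qed.

Lemma facet_closure_min S T : facet_closed T -> S \subset T -> facet_closure S \subset T.
Proof. by move=> /eqP {2}<-; exact: facet_closure_subset. Qed.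

(* The rank is the dimension of the face plus one, so that the empty face has
   rank 0. *)
Record rank_function (r : {set 'I_n} -> nat) : Prop := RankFunction {
  closed0 : facet_closed set0;
  rank0 : r set0 = 0;
  rank_lt : forall S T, facet_closed S -> facet_closed T -> S \proper T -> r S < r T;
  rank_graded : forall S T, facet_closed S -> facet_closed T -> S \proper T ->
    exists U, [/\ facet_closed U, S \subset U, U \proper T & r T = (r U).+1] }.

End ClosureSystem.

(** * Program logic with running times *)

(** Total correctness with a time bound; execution being deterministic, the existential speaks of
    the only run. *)
Definition runs (p : prog) (s : state) (T : nat) (Q : state -> Prop) : Prop :=
  exists t s', [/\ exec p s t s', t <= T & Q s'].

Fixpoint written_vars (p : prog) : seq nat :=
  match p with
  | Skip | Store _ _ _ => [::]
  | Assign x _ => [:: x]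
  | Seq p q | If _ p q => written_vars p ++ written_vars q
  | While _ p => written_vars p
  end.

Fixpoint written_arrs (p : prog) : seq nat :=
  match p with
  | Skip | Assign _ _ => [::]
  | Store a _ _ => [:: a]
  | Seq p q | If _ p q => written_arrs p ++ written_arrs q
  | While _ p => written_arrs p
  end.

(** Frame condition read off the syntax. Its side conditions are closed Boolean computations,
    discharged below by [isT], so that assertions need only mention what a program changes. *)
Definition same (p : prog) (s s' : state) : Prop :=
  (forall x, x \notin written_vars p -> var s' x = var s x) /\
  (forall a i, a \notin written_arrs p -> arr s' a i = arr s a i).

Lemma exec_same p s t s' : exec p s t s' -> same p s s'.
Proof.
elim=> {p s t s'} //.
- by move=> s x e; split=> //= y; rewrite inE => /negPf ->.
- by move=> s a e1 e2; split=> //= b i; rewrite inE => /negPf ->.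
- move=> s s1 s2 p q t1 t2 _ [v1 a1] _ [v2 a2]; split=> /= [x | a i];
    rewrite mem_cat negb_or => /andP[h1 h2]; first by rewrite v2 ?v1.
  by rewrite a2 ?a1.
- move=> s s1 e p q t _ _ [v1 a1]; split=> /= [x | a i];
    rewrite mem_cat negb_or => /andP[h1 h2]; [exact: v1 | exact: a1].
- move=> s s1 e p q t _ _ [v1 a1]; split=> /= [x | a i];
    rewrite mem_cat negb_or => /andP[h1 h2]; [exact: v1 | exact: a1].
- move=> s s1 s2 e p t1 t2 _ _ [v1 a1] _ [v2 a2].
  by split=> /= [x h | a i h]; rewrite ?v2 ?v1 ?a2 ?a1.
Qed.

Lemma runs_weaken p s T T' (Q Q' : state -> Prop) : runs p s T Q -> T <= T' ->
  (forall s', same p s s' -> Q s' -> Q' s') -> runs p s T' Q'.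
Proof.
move=> [t [s' [ex le q]]] TT h; exists t, s'; split=> //; first exact: leq_trans TT.
by apply: h => //; exact: exec_same ex.
Qed.

Lemma runs_skip s T (Q : state -> Prop) : 1 <= T -> Q s -> runs Skip s T Q.
Proof. by move=> h q; exists 1, s; split=> //; exact: ExecSkip. Qed.

Lemma runs_assign x e s T (Q : state -> Prop) : (cost e).+1 <= T ->
  Q (set_var s x (eval s e)) -> runs (Assign x e) s T Q.
Proof. by move=> h q; do 2 eexists; split; [exact: ExecAssign | |]. Qed.

Lemma runs_store a e1 e2 s T (Q : state -> Prop) : (cost e1 + cost e2).+1 <= T ->
  Q (set_arr s a (eval s e1) (eval s e2)) -> runs (Store a e1 e2) s T Q.
Proof. by move=> h q; do 2 eexists; split; [exact: ExecStore | |]. Qed.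

Lemma runs_seq p q s T1 T2 (Q Q' : state -> Prop) : runs p s T1 Q ->
  (forall s1, same p s s1 -> Q s1 -> runs q s1 T2 Q') ->
  runs (Seq p q) s (T1 + T2) Q'.
Proof.
move=> [t1 [s1 [ex1 le1 q1]]] /(_ s1 (exec_same ex1) q1).
move=> [t2 [s2 [ex2 le2 q2]]]; exists (t1 + t2), s2; split=> //.
  exact: ExecSeq ex1 ex2.
exact: leq_add.
Qed.

Lemma runs_seq_assign x e q s T (Q : state -> Prop) : (cost e).+1 <= T ->
  runs q (set_var s x (eval s e)) (T - (cost e).+1) Q ->
  runs (Seq (Assign x e) q) s T Q.
Proof.
move=> h [t [s' [ex le H]]]; exists ((cost e).+1 + t), s'; split=> //; last by lia.
exact: ExecSeq (ExecAssign _ _ _) ex.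
Qed.

Lemma runs_seq_store a e1 e2 q s T (Q : state -> Prop) :
  (cost e1 + cost e2).+1 <= T ->
  runs q (set_arr s a (eval s e1) (eval s e2)) (T - (cost e1 + cost e2).+1) Q ->
  runs (Seq (Store a e1 e2) q) s T Q.
Proof.
move=> h [t [s' [ex le H]]]; exists ((cost e1 + cost e2).+1 + t), s'.
split=> //; last by lia.
exact: ExecSeq (ExecStore _ _ _ _) ex.
Qed.

Lemma runs_if e p q s T (Q : state -> Prop) : (cost e).+1 <= T ->
  (eval s e != 0 -> runs p s (T - (cost e).+1) Q) ->
  (eval s e = 0 -> runs q s (T - (cost e).+1) Q) ->
  runs (If e p q) s T Q.
Proof.
move=> h hp hq; case: (eqVneq (eval s e) 0) => c.
  have [t [s' [ex le H]]] := hq c; exists (cost e + t).+1, s'.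
  by split=> //; [exact: ExecIfFalse | lia].
have [t [s' [ex le H]]] := hp c; exists (cost e + t).+1, s'.
by split=> //; [exact: ExecIfTrue | lia].
Qed.

Definition For (i x : nat) (body : prog) : prog :=
  Seq (Assign i (Const 0))
      (While (Bin Lt (Var i) (Var x))
             (Seq body (Assign i (Bin Plus (Var i) (Const 1))))).

(** A round costs [T] for the body, 4 for the test and 4 for the increment; the initial assignment
    and the failing last test cost 6. The invariant is asked of states whose counter already has its
    new value. *)
Lemma runs_for i x body s N T (Inv : nat -> state -> Prop) :
  var s x = N -> i \notin written_vars body -> x \notin i :: written_vars body ->
  Inv 0 (set_var s i 0) ->
  (forall j s1, j < N -> var s1 i = j -> same (For i x body) s s1 -> Inv j s1 ->
     runs body s1 T (fun s2 => Inv j.+1 (set_var s2 i j.+1))) ->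
  runs (For i x body) s (N * (T + 8) + 6) (Inv N).
Proof.
move=> xN ib xb I0 step.
have loop j s1 : j <= N -> var s1 i = j -> same (For i x body) s s1 -> Inv j s1 ->
    runs (While (Bin Lt (Var i) (Var x))
             (Seq body (Assign i (Bin Plus (Var i) (Const 1))))) s1
         ((N - j) * (T + 8) + 4) (Inv N).
  move Dn: (N - j) => l; elim: l j s1 Dn => [|l IH] j s1 Dl jN s1i sm Ij.
    have ejN : j = N by lia.
    exists 4, s1; split=> //; last by rewrite -ejN.
    have sx : var s1 x = N.
      rewrite -xN; case: sm => -> //.
      move: xb; rewrite inE negb_or => /andP[h1 h2].
      by rewrite /= inE mem_cat inE !negb_or h1 h2.
    apply: (ExecWhileFalse (e := Bin Lt (Var i) (Var x))).
    by rewrite /= s1i sx ejN ltnn.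
  have lt : j < N by lia.
  have sx : var s1 x = N.
    rewrite -xN; case: sm => -> //.
    move: xb; rewrite inE negb_or => /andP[h1 h2].
    by rewrite /= inE mem_cat inE !negb_or h1 h2.
  have [t1 [s2 [ex1 le1 I1]]] := step j s1 lt s1i sm Ij.
  have s2i : var s2 i = j by case: (exec_same ex1) => /(_ i ib) -> _.
  have [|//| | t2 [s3 [ex2 le2 I2]]] := IH j.+1 (set_var s2 i j.+1) _ lt _ _ I1.
  - lia.
  - by rewrite /= eqxx.
  - case: (exec_same ex1) => v1 a1; case: sm => v0 a0; split=> /= [y|a y].
      rewrite inE mem_cat inE !negb_or => /and3P[h1 h2 h3].
      rewrite (negPf h1) v1 // v0 //=; by rewrite inE mem_cat inE !negb_or h1 h2.
    rewrite cats0 => h; rewrite a1 // a0 //=; by rewrite cats0.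
  exists ((3 + (t1 + 4) + t2).+1), s3; split=> //.
    apply: (ExecWhileTrue (e := Bin Lt (Var i) (Var x)) (s1 := set_var s2 i j.+1)) => //.
      by rewrite /= s1i sx lt.
    apply: ExecSeq ex1 _.
    have <- : eval s2 (Bin Plus (Var i) (Const 1)) = j.+1 by rewrite /= s2i addn1.
    exact: ExecAssign.
  rewrite mulSn; lia.
have [|||| t [s' [ex le H]]] := loop 0 (set_var s i 0).
- by [].
- by rewrite /= eqxx.
- split=> //= y; by rewrite inE negb_or => /andP[/negPf ->].
- exact: I0.
exists (2 + t), s'; split=> //; last by lia.
exact: ExecSeq (ExecAssign s i (Const 0)) ex.
Qed.

(** * The program *)

(* Variables 0, 1, 2 and array 0 are prescribed by the input, variables 0, 1 and
   arrays 0, 1 by the output; array 0 is reused for the tails once the matrix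
   has been read. *)
Local Notation vM := 0 (only parsing).
Local Notation vN := 1 (only parsing).
Local Notation vK := 2 (only parsing).
Local Notation vF := 3 (only parsing).
Local Notation vV := 4 (only parsing).
Local Notation vU := 5 (only parsing).
Local Notation vE := 6 (only parsing).
Local Notation vPos := 7 (only parsing).
Local Notation vInc := 8 (only parsing).
Local Notation vNodes := 9 (only parsing).
Local Notation vArcs := 10 (only parsing).
Local Notation vQ := 11 (only parsing).
Local Notation vQn := 12 (only parsing).
Local Notation vEnd := 13 (only parsing).
Local Notation vCard := 14 (only parsing).
Local Notation vFull := 15 (only parsing).
Local Notation vSize := 16 (only parsing).
Local Notation vCode := 17 (only parsing).
Local Notation vBad := 18 (only parsing).
Local Notation aTail := 0 (only parsing).
Local Notation aHead := 1 (only parsing).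
Local Notation aFacet := 2 (only parsing).
Local Notation aVertex := 3 (only parsing).
Local Notation aFace := 4 (only parsing).
Local Notation aRank := 5 (only parsing).
Local Notation aId := 6 (only parsing).
Local Notation aSet := 7 (only parsing).
Local Notation aMeet := 8 (only parsing).
Local Notation aCount := 9 (only parsing).
Local Notation aCard := 10 (only parsing).
Local Notation aClosure := 11 (only parsing).

Declare Scope prog_scope.
Delimit Scope prog_scope with P.
Local Notation "$ x" := (Var x) (at level 8, x at level 8, format "$ x") : prog_scope.
Local Notation "# c" := (Const c) (at level 8, c at level 8) : prog_scope.
Local Notation "a .[ e ]" := (Get a e) : prog_scope.
Local Notation "x + y" := (Bin Plus x y) : prog_scope.
Local Notation "x - y" := (Bin Minus x y) : prog_scope.
Local Notation "x == y" := (Bin Eq x y) : prog_scope.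
Local Notation "x <= y" := (Bin Leq x y) : prog_scope.
Local Notation "x < y" := (Bin Lt x y) : prog_scope.
Local Notation "x ::= e" := (Assign x e) (at level 80) : prog_scope.
Local Notation "p ;; q" := (Seq p q) (at level 90, right associativity) : prog_scope.
Bind Scope prog_scope with prog expr.

(** The sum of the two Booleans is the indicator of the face with [vV] added only if [vV] lies
    outside the face; the callers test this. *)
Definition load_set : prog := (
  vCard ::= #0 ;;
  For vU vN (
    Store aCount ($vU) (#0) ;;
    Store aSet ($vU) (aFace.[$vQn + $vU] + ($vU == $vV)) ;;
    vCard ::= $vCard + aSet.[$vU]))%P.

Definition count_in_facets : prog := (
  For vF vM (Store aMeet ($vF) (#0)) ;;
  For vE vInc (
    Store aMeet (aFacet.[$vE]) (aMeet.[aFacet.[$vE]] + aSet.[aVertex.[$vE]])))%P.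

Definition count_full_facets : prog := (
  vFull ::= #0 ;;
  For vF vM (vFull ::= $vFull + (aMeet.[$vF] == $vCard)) ;;
  For vE vInc (
    Store aCount (aVertex.[$vE])
      (aCount.[aVertex.[$vE]] + (aMeet.[aFacet.[$vE]] == $vCard))))%P.

Definition store_closure : prog := (
  vSize ::= #0 ;; vCode ::= #0 ;;
  For vU vN (
    Store aClosure ($vU) ((aCount.[$vU] == $vFull)) ;;
    vSize ::= $vSize + aClosure.[$vU] ;;
    vCode ::= ($vCode + $vCode) + aClosure.[$vU]))%P.

(** Two counting passes over the incidences: a facet contains the set iff it has as many incidences
    with it as the set has elements, and a vertex lies in the closure iff it lies on as many of
    these facets as there are. Hence time linear in m + n + alpha, not in mn. *)
Definition compute_closure : prog :=
  (load_set ;; count_in_facets ;; count_full_facets ;; store_closure)%P.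

(** One closure is judged by the cardinalities of the others, so all of these must be known before a
    cover is emitted. The closures themselves are not kept but computed again in [emit_covers]. *)
Definition compute_cards : prog := (
  For vV vN (
    If (aFace.[$vQn + $vV]) Skip
       (compute_closure ;; Store aCard ($vV) ($vSize))))%P.

(* vBad counts the vertices u of the closure, outside the current face, that
   witness that the closure is not minimal or that vV is not the least vertex
   generating it. *)
Definition test_cover : prog := (
  vBad ::= #0 ;;
  For vU vN (
    vBad ::= $vBad +
      (((aCard.[$vU] == $vSize) + ($vV <= $vU)) <
       ((aFace.[$vQn + $vU] < aClosure.[$vU]) +
        (aFace.[$vQn + $vU] < aClosure.[$vU])))))%P.

(* Faces are looked up by direct addressing: vCode is the closure read as an
   n-bit number, and aId holds at this address the number of the face plus one,
   or 0 if the face is new. *)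
Definition insert_face : prog := (
  Store aId ($vCode) ($vNodes + #1) ;;
  Store aRank ($vNodes) (aRank.[$vQ] + #1) ;;
  For vU vN (Store aFace ($vEnd + $vU) (aClosure.[$vU])) ;;
  vNodes ::= $vNodes + #1 ;;
  vEnd ::= $vEnd + $vN)%P.

Definition emit_cover : prog := (
  If (aId.[$vCode]) Skip insert_face ;;
  Store aTail ($vArcs) ($vQ) ;;
  Store aHead ($vArcs) (aId.[$vCode] - #1) ;;
  vArcs ::= $vArcs + #1)%P.

Definition emit_covers : prog := (
  For vV vN (
    If (aFace.[$vQn + $vV]) Skip
       (compute_closure ;; test_cover ;; If ($vBad == #0) emit_cover Skip)))%P.

(** The rank is the dimension plus one, so faces of dimension k are listed but not expanded. [vQn],
    like [vEnd], is a multiple of n maintained by additions. *)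
Definition explore_face : prog := (
  If (aRank.[$vQ] <= $vK) (compute_cards ;; emit_covers) Skip ;;
  vQ ::= $vQ + #1 ;;
  vQn ::= $vQn + $vN)%P.

Definition explore : prog := (While ($vQ < $vNodes) explore_face)%P.

Definition read_matrix : prog := (
  For vF vM (
    For vV vN (
      If (0.[$vPos])
        (Store aFacet ($vInc) ($vF) ;; Store aVertex ($vInc) ($vV) ;;
         vInc ::= $vInc + #1)
        Skip ;;
      vPos ::= $vPos + #1)))%P.

(** The empty face gets number 0. Its row in [aFace] and its rank are zeros of the initial memory,
    and its code is 0, so only its identifier has to be stored. *)
Definition skeleton_prog : prog := (
  read_matrix ;;
  Store aId (#0) (#1) ;; vNodes ::= #1 ;; vEnd ::= $vN ;;
  explore ;;
  0 ::= $vNodes ;; 1 ::= $vArcs)%P.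

(** * Correctness of the closure computation *)

Definition bits_code (s : seq bool) : nat := foldl (fun c (b : bool) => c + c + b) 0 s.

Lemma bits_code_rcons s (b : bool) :
  bits_code (rcons s b) = bits_code s + bits_code s + b.
Proof. by rewrite /bits_code foldl_rcons. Qed.

Lemma bits_code_inj s1 s2 : size s1 = size s2 -> bits_code s1 = bits_code s2 -> s1 = s2.
Proof.
elim/last_ind: s1 s2 => [|s1 b1 IH] s2; first by case: s2.
case/lastP: s2 => [|s2 b2]; rewrite ?size_rcons // => -[sz].
rewrite !bits_code_rcons => e; have eb : b1 = b2 by case: b1 b2 e => [] []; lia.
by rewrite eb (IH s2) //; move: e; rewrite eb; lia.
Qed.

Section Correctness.
Variables (m n : nat) (A : 'M[bool]_(m, n)).
Implicit Types S T U : {set 'I_n}.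

(** Indexed by natural numbers, as it describes array cells; false from n on. *)
Definition chi S (u : nat) : bool := [exists w : 'I_n, (w \in S) && (u == w)].

Lemma chiE S (w : 'I_n) : chi S w = (w \in S).
Proof.
apply/existsP/idP => [[w' /andP[h /eqP/val_inj ->]] // | h].
by exists w; rewrite h /=.
Qed.

Lemma sum_chi S : \sum_(0 <= u < n) chi S u = #|S|.
Proof.
rewrite big_mkord -sum1_card [RHS]big_mkcond /=.
by apply: eq_bigr => u _; rewrite chiE; case: (u \in S).
Qed.

Definition prefix_code S (j : nat) : nat := bits_code [seq chi S u | u <- iota 0 j].

Arguments prefix_code : simpl never.

Lemma prefix_codeS S j :
  prefix_code S j.+1 = prefix_code S j + prefix_code S j + chi S j.
Proof. by rewrite /prefix_code -[j.+1]addn1 iotaD map_cat cats1 bits_code_rcons. Qed.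

Definition set_code S : nat := prefix_code S n.

Lemma set_code_inj : injective set_code.
Proof.
move=> S T /bits_code_inj; rewrite !size_map => /(_ erefl) /eq_in_map h.
by apply/setP => u; rewrite -!chiE; apply: h; rewrite mem_iota /=.
Qed.

Lemma set_code0 : set_code set0 = 0.
Proof.
rewrite /set_code /prefix_code (_ : [seq _ | u <- _] = nseq n false).
  by elim: n => // n' IH; rewrite -addn1 nseqD cats1 bits_code_rcons IH.
have chi0 u : chi set0 u = false by apply/existsP => -[w]; rewrite inE.
by rewrite (eq_map chi0); elim: n 0 => //= n' IH k; rewrite IH.
Qed.

Definition incident (p : nat) : bool :=
  [exists f : 'I_m, exists v : 'I_n, (p == f * n + v) && A f v].

Definition edges (t : nat) : seq (nat * nat) :=
  [seq (p %/ n, p %% n) | p <- iota 0 t & incident p].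

Definition incidences := edges (m * n).

Lemma pos_divmod (f : nat) (v : 'I_n) :
  ((f * n + v) %/ n = f) * ((f * n + v) %% n = v).
Proof.
have n0 : 0 < n by apply: leq_ltn_trans (ltn_ord v).
by rewrite divnMDl // divn_small ?addn0 ?ltn_ord // modnMDl modn_small.
Qed.

Lemma incidentE (f : 'I_m) (v : 'I_n) : incident (f * n + v) = A f v.
Proof.
apply/existsP/idP => [[f' /existsP[v' /andP[/eqP e Afv]]] | Afv].
  have ef : f = f' by apply: val_inj; rewrite /= -(pos_divmod f v).1 e pos_divmod.
  have ev : v = v' by apply: val_inj; rewrite /= -(pos_divmod f v).2 e pos_divmod.
  by rewrite ef ev.
by exists f; apply/existsP; exists v; rewrite eqxx.
Qed.

(** Each incidence occurs exactly once in the list, so a pass over it evaluates a double sum over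
    the matrix; both counting passes rest on this. *)
Lemma sum_incidences (F : nat * nat -> nat) :
  \sum_(p <- incidences) F p =
  \sum_(f < m) \sum_(v < n) (if A f v then F (val f, val v) else 0).
Proof.
transitivity (\sum_(0 <= p < m * n) (if incident p then F (p %/ n, p %% n) else 0)).
  by rewrite /incidences /edges big_map big_filter big_mkcond /index_iota subn0.
have H k : k <= m -> \sum_(0 <= p < k * n) (if incident p then F (p %/ n, p %% n) else 0)
  = \sum_(0 <= f < k) \sum_(v < n) (if incident (f * n + v) then F (f, val v) else 0).
  elim: k => [|k IH] lt; first by rewrite mul0n !big_geq.
  rewrite mulSn addnC (@big_cat_nat _ _ _ (k * n)) ?leq_addr //= big_nat_recr //=.
  rewrite -IH ?(ltnW lt) //; congr (_ + _).
  rewrite -{1}[k * n]add0n big_addn addKn big_mkord; apply: eq_bigr => v _.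
  by rewrite addnC !pos_divmod.
rewrite H // big_mkord; apply: eq_bigr => f _; apply: eq_bigr => v _.
by rewrite incidentE.
Qed.

Lemma size_incidences : size incidences = num_incidences A.
Proof.
rewrite -sum1_size sum_incidences pair_big /= /num_incidences -sum1_card.
by rewrite [RHS]big_mkcond; apply: eq_bigr => -[f v] _; rewrite inE.
Qed.

Lemma mem_incidences p : p \in incidences -> p.1 < m /\ p.2 < n.
Proof.
case/mapP => t; rewrite mem_filter => /andP[/existsP[f /existsP[v /andP[/eqP -> _]]] _].
by move=> ->; rewrite /= !pos_divmod !ltn_ord.
Qed.

Lemma nth_incidences e : e < size incidences ->
  (nth (0, 0) incidences e).1 < m /\ (nth (0, 0) incidences e).2 < n.
Proof. by move=> lt; apply/mem_incidences/mem_nth. Qed.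

Definition facet_card S (f : nat) : nat :=
  \sum_(p <- incidences) ((p.1 == f) && chi S p.2).

Lemma facet_cardE S (f : 'I_m) : facet_card S f = #|[set v in S | A f v]|.
Proof.
rewrite /facet_card sum_incidences (bigD1 f) //= [X in _ + X]big1 ?addn0; last first.
  move=> f' nf; rewrite big1 // => v _; case: ifP => // _.
  by rewrite (inj_eq val_inj) (negPf nf).
rewrite -sum1_card [RHS]big_mkcond; apply: eq_bigr => v _.
by rewrite eqxx chiE inE; case: (A f v); case: (v \in S).
Qed.

Definition full_facet S (f : nat) : bool := facet_card S f == #|S|.

Lemma full_facetP S (f : 'I_m) : reflect (forall w, w \in S -> A f w) (full_facet S f).
Proof.
have s : [set v in S | A f v] \subset S by apply/subsetP => v; rewrite inE => /andP[].
rewrite /full_facet facet_cardE; apply: (iffP eqP) => [e w wS | h].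
  have /eqP E : [set v in S | A f v] == S by rewrite eqEcard s e /=.
  by move: wS; rewrite -{1}E inE => /andP[].
congr #|pred_of_set _|; apply/setP => v; rewrite inE.
by apply/andb_idr => /h.
Qed.

(** The facets containing S and v are among those containing S, so equal numbers mean that the two
    families coincide. *)
Lemma closure_count S (v : 'I_n) :
  (\sum_(p <- incidences) ((p.2 == v) && full_facet S p.1) == \sum_(0 <= f < m) full_facet S f)
  = (v \in facet_closure A S).
Proof.
have -> : \sum_(p <- incidences) ((p.2 == v) && full_facet S p.1) =
    #|[set f : 'I_m | full_facet S f && A f v]|.
  rewrite sum_incidences -sum1_card [RHS]big_mkcond; apply: eq_bigr => f _.
  rewrite (bigD1 v) //= big1 ?addn0 => [|w nw].
    by rewrite eqxx inE; case: (A f v); case: (full_facet S f).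
  by case: ifP => // _; rewrite (inj_eq val_inj) (negPf nw).
have -> : \sum_(0 <= f < m) full_facet S f = #|[set f : 'I_m | full_facet S f]|.
  rewrite big_mkord -sum1_card [RHS]big_mkcond; apply: eq_bigr => f _.
  by rewrite inE; case: (full_facet S f).
have s : [set f : 'I_m | full_facet S f && A f v] \subset [set f : 'I_m | full_facet S f].
  by apply/subsetP => f; rewrite !inE => /andP[].
apply/eqP/facet_closureP => [e f /full_facetP hf | h].
  have /eqP E : [set f : 'I_m | full_facet S f && A f v] == [set f : 'I_m | full_facet S f].
    by rewrite eqEcard s e /=.
  have : f \in [set f : 'I_m | full_facet S f] by rewrite inE.
  by rewrite -E inE => /andP[].
congr #|pred_of_set _|; apply/setP => f; rewrite !inE.
by apply/andb_idr => /full_facetP/h.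
Qed.

Definition loaded (s : state) : Prop :=
  [/\ var s vM = m, var s vN = n, var s vInc = size incidences &
   forall e, e < size incidences ->
     arr s aFacet e = (nth (0, 0) incidences e).1 /\
     arr s aVertex e = (nth (0, 0) incidences e).2].

Lemma loaded_same p s s' : same p s s' ->
  ~~ has (mem (written_vars p)) [:: vM; vN; vInc] ->
  ~~ has (mem (written_arrs p)) [:: aFacet; aVertex] ->
  loaded s -> loaded s'.
Proof.
move=> [sv sa] /hasPn hv /hasPn ha [h1 h2 h3 h4].
split; rewrite ?sv //; try by apply: hv.
move=> e /h4 [h5 h6]; rewrite !sa //; by apply: ha.
Qed.

Lemma chi_setU1 S (v : 'I_n) u : v \notin S -> u < n ->
  chi (v |: S) u = chi S u + (u == v) :> nat.
Proof.
move=> vS lt; have -> : u = Ordinal lt by [].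
rewrite !chiE in_setU1 (inj_eq val_inj).
by case: eqVneq => [-> | _]; rewrite ?(negPf vS) //= addn0.
Qed.

Lemma load_set_runs s S (v : 'I_n) : var s vN = n -> var s vV = v -> v \notin S ->
  (forall u, u < n -> arr s aFace (var s vQn + u) = chi S u) ->
  runs load_set s (n * 28 + 8) (fun s' =>
    [/\ var s' vCard = #|v |: S|,
        forall u, u < n -> arr s' aSet u = chi (v |: S) u &
        forall u, u < n -> arr s' aCount u = 0]).
Proof.
move=> sN sV vS sF; apply: runs_seq_assign; first by rewrite /=; lia.
set s0 := set_var _ _ _.
have := @runs_for vU vN _ s0 n 20 (fun j s1 =>
  [/\ var s1 vCard = \sum_(0 <= u < j) chi (v |: S) u,
      forall u, u < j -> arr s1 aSet u = chi (v |: S) u &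
      forall u, u < j -> arr s1 aCount u = 0]).
rewrite sum_chi => H; apply: (runs_weaken (H _ _ _ _ _ _)) => //=; last by lia.
- by split=> //; rewrite big_geq.
- move=> j s1 jn sj fr [I1 I2 I3].
  apply: runs_seq_store => //; apply: runs_seq_store => //; apply: runs_assign => //=.
  have jN := fr.1 vQn isT; have jV := fr.1 vV isT.
  have jF := fr.2 aFace (var s vQn + j) isT.
  rewrite /= in jN jV jF.
  have e : arr s1 aFace (var s1 vQn + var s1 vU) + (var s1 vU == var s1 vV) =
      chi (v |: S) j by rewrite chi_setU1 // jN jV sj jF sF // sV.
  rewrite eqxx e sj; split=> [|u|u].
  + by rewrite big_nat_recr //= I1.
  + by rewrite ltnS leq_eqVlt; case: eqVneq => [-> //| _ /=]; exact: I2.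
  + by rewrite ltnS leq_eqVlt; case: eqVneq => [-> //| _ /=]; exact: I3.
Qed.

Lemma sum_take_incidences (F : nat * nat -> nat) j : j < size incidences ->
  \sum_(p <- take j.+1 incidences) F p =
  \sum_(p <- take j incidences) F p + F (nth (0, 0) incidences j).
Proof. by move=> lt; rewrite (take_nth (0, 0)) // -cats1 big_cat big_seq1. Qed.

Lemma count_in_facets_runs s U : loaded s ->
  (forall u, u < n -> arr s aSet u = chi U u) ->
  runs count_in_facets s (m * 11 + size incidences * 18 + 12) (fun s' =>
    forall f, f < m -> arr s' aMeet f = facet_card U f).
Proof.
move=> ls sU; have [sM _ _ _] := ls.
apply: (runs_weaken (T := (m * (3 + 8) + 6) + (size incidences * (10 + 8) + 6))
  (Q := fun s' => forall f, f < m -> arr s' aMeet f = facet_card U f)) => //;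
  last by lia.
apply: (@runs_seq _ _ _ _ _ (fun s1 => forall f, f < m -> arr s1 aMeet f = 0)).
  apply: (@runs_for _ _ _ _ _ _
    (fun j s1 => forall f, f < j -> arr s1 aMeet f = 0)) => //.
  move=> j s1 jm sj fr I; apply: runs_store => //= f.
  by rewrite sj ltnS leq_eqVlt; case: eqVneq => [-> // | _ /=]; exact: I.
move=> s1 fr1 I1.
have [s1M _ s1E s1i] := loaded_same fr1 isT isT ls.
pose Inv j (s2 : state) := forall f, f < m -> arr s2 aMeet f =
  \sum_(p <- take j incidences) ((p.1 == f) && chi U p.2).
apply: (@runs_weaken _ _ _ _ (Inv (size incidences)) _ _ (leqnn _)); last first.
  by move=> s2 _ I2 f lt; rewrite I2 // take_size.
apply: runs_for => //.
  by move=> f lt; rewrite take0 big_nil /= I1.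
move=> j s2 jE sj fr I; apply: runs_store => // f lt /=.
have [e1 e2] := s1i _ jE; have [lf lv] := nth_incidences jE.
have f1 := fr.2 aFacet j isT; have f2 := fr.2 aVertex j isT.
have f3 := fr.2 aSet (nth (0, 0) incidences j).2 isT.
have f4 := fr1.2 aSet (nth (0, 0) incidences j).2 isT.
rewrite sj f1 f2 e1 e2 f3 f4 sU // sum_take_incidences // eq_sym.
case: eqVneq => [<- /= | _ /=]; first by rewrite I.
by rewrite addn0 I.
Qed.

Lemma count_full_facets_runs s U : loaded s ->
  (forall f, f < m -> arr s aMeet f = facet_card U f) ->
  (forall u, u < n -> arr s aCount u = 0) ->
  var s vCard = #|U| ->
  runs count_full_facets s (m * 15 + size incidences * 20 + 14) (fun s' =>
    var s' vFull = \sum_(0 <= f < m) full_facet U f /\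
    forall u, u < n -> arr s' aCount u =
      \sum_(p <- incidences) ((p.2 == u) && full_facet U p.1)).
Proof.
move=> ls sM sC cU; have [vm _ _ _] := ls.
apply: runs_seq_assign; first by rewrite /=; lia.
set s0 := set_var _ _ _.
have ls0 : loaded s0 by [].
apply: (@runs_weaken _ _ ((m * (7 + 8) + 6) + (size incidences * (12 + 8) + 6)) _
  (fun s' => var s' vFull = \sum_(0 <= f < m) full_facet U f /\
    forall u, u < n -> arr s' aCount u =
      \sum_(p <- incidences) ((p.2 == u) && full_facet U p.1))) => //;
  last by rewrite /=; lia.
apply: (@runs_seq _ _ _ _ _
  (fun s1 => var s1 vFull = \sum_(0 <= f < m) full_facet U f)).
  apply: (@runs_for _ _ _ _ _ _
    (fun j s1 => var s1 vFull = \sum_(0 <= f < j) full_facet U f)) => //.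
    by rewrite big_geq.
  move=> j s1 jm sj fr I; apply: runs_assign => //=.
  have f1 := fr.2 aMeet j isT; have f2 := fr.1 vCard isT.
  by rewrite /= in f1 f2; rewrite big_nat_recr //= I sj f1 f2 sM // cU.
move=> s1 fr1 I1.
have [s1M _ s1E s1i] := loaded_same fr1 isT isT ls0.
pose Inv j (s2 : state) := forall u, u < n -> arr s2 aCount u =
  \sum_(p <- take j incidences) ((p.2 == u) && full_facet U p.1).
apply: (@runs_weaken _ _ _ _ (Inv (size incidences)) _ _ (leqnn _)); last first.
  move=> s2 fr I2; split; first by rewrite (fr.1 vFull isT).
  by move=> u lt; rewrite I2 // take_size.
apply: runs_for => //.
  by move=> u lt; rewrite take0 big_nil /= (fr1.2 aCount u isT) sC.
move=> j s2 jE sj fr I; apply: runs_store => // u lt /=.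
have [e1 e2] := s1i _ jE; have [lf lv] := nth_incidences jE.
have f1 := fr.2 aFacet j isT; have f2 := fr.2 aVertex j isT.
have f3 := fr.2 aMeet (nth (0, 0) incidences j).1 isT.
have f4 := fr1.2 aMeet (nth (0, 0) incidences j).1 isT.
have f5 := fr.1 vCard isT; have f6 := fr1.1 vCard isT.
rewrite /= in f3 f4 f5 f6.
rewrite sj f1 f2 e1 e2 f3 f4 f5 f6 sM // cU sum_take_incidences // eq_sym.
case: eqVneq => [<- /= | _ /=]; first by rewrite I.
by rewrite addn0 I.
Qed.

Lemma store_closure_runs s U : var s vN = n ->
  var s vFull = \sum_(0 <= f < m) full_facet U f ->
  (forall u, u < n -> arr s aCount u =
      \sum_(p <- incidences) ((p.2 == u) && full_facet U p.1)) ->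
  runs store_closure s (n * 28 + 10) (fun s' =>
    [/\ var s' vSize = #|facet_closure A U|,
        var s' vCode = set_code (facet_closure A U) &
        forall u, u < n -> arr s' aClosure u = chi (facet_closure A U) u]).
Proof.
move=> sN sF sC; set V := facet_closure A U.
apply: runs_seq_assign; first by rewrite /=; lia.
apply: runs_seq_assign; first by rewrite /=; lia.
set s0 := set_var _ _ _.
have H := @runs_for vU vN _ s0 n 20 (fun j s1 =>
  [/\ var s1 vSize = \sum_(0 <= u < j) chi V u,
      var s1 vCode = prefix_code V j &
      forall u, u < j -> arr s1 aClosure u = chi V u]).
rewrite sum_chi in H; apply: (runs_weaken (H _ _ _ _ _ _)) => //=; last by lia.
  by split=> //; rewrite big_geq.
move=> j s1 jn sj fr [I1 I2 I3].
apply: runs_seq_store => //; apply: runs_seq_assign => //; apply: runs_assign => //=.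
have f1 := fr.1 vFull isT; have f2 := fr.2 aCount j isT; rewrite /= in f1 f2.
have e : (arr s1 aCount (var s1 vU) == var s1 vFull) = chi V j.
  by rewrite sj f1 f2 sC // sF -[j]/(val (Ordinal jn)) closure_count chiE.
rewrite eqxx e sj; split=> [||u].
- by rewrite big_nat_recr //= I1.
- by rewrite prefix_codeS -I2.
- by rewrite ltnS leq_eqVlt; case: eqVneq => [-> // | _ /=]; exact: I3.
Qed.

(** The sum of the bounds for the four passes, with the constant 44 rounded up. *)
Definition closure_time : nat := 56 * n + 26 * m + 38 * size incidences + 50.

Lemma compute_closure_runs s S (v : 'I_n) : loaded s -> var s vV = v -> v \notin S ->
  (forall u, u < n -> arr s aFace (var s vQn + u) = chi S u) ->
  runs compute_closure s closure_time (fun s' =>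
    [/\ var s' vSize = #|facet_closure A (v |: S)|,
        var s' vCode = set_code (facet_closure A (v |: S)) &
        forall u, u < n -> arr s' aClosure u = chi (facet_closure A (v |: S)) u]).
Proof.
move=> ls sV vS sF; have [_ sN _ _] := ls; set U := v |: S.
apply: (@runs_weaken _ _ ((n * 28 + 8) + ((m * 11 + size incidences * 18 + 12) +
  ((m * 15 + size incidences * 20 + 14) + (n * 28 + 10)))) _ (fun s' =>
    [/\ var s' vSize = #|facet_closure A U|,
        var s' vCode = set_code (facet_closure A U) &
        forall u, u < n -> arr s' aClosure u = chi (facet_closure A U) u])) => //;
  last by rewrite /closure_time; lia.
apply: runs_seq; first exact: load_set_runs sN sV vS sF.
move=> s1 fr1 [c1 set1 cnt1]; have ls1 := loaded_same fr1 isT isT ls.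
apply: runs_seq; first exact: count_in_facets_runs ls1 set1.
move=> s2 fr2 meet2; have ls2 := loaded_same fr2 isT isT ls1.
apply: runs_seq.
  apply: (count_full_facets_runs ls2 meet2); last by rewrite (fr2.1 vCard isT).
  by move=> u lt; rewrite (fr2.2 aCount u isT) cnt1.
move=> s3 fr3 [full3 cnt3]; have [_ n3 _ _] := loaded_same fr3 isT isT ls2.
exact: store_closure_runs n3 full3 cnt3.
Qed.

(** * Covers and the exploration invariant *)

Variables (r : {set 'I_n} -> nat) (k : nat).
Hypothesis rP : rank_function A r.

Definition covers T U := [&& facet_closed A U, T \proper U & r U == (r T).+1].

Definition least_new T U (v : 'I_n) : Prop :=
  [/\ v \in U, v \notin T & forall u, u \in U -> u \notin T -> v <= u].

Lemma setU1_facet_closure T (v : 'I_n) : v \notin T ->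
  T \proper facet_closure A (v |: T).
Proof.
move=> vT; have s := subset_facet_closure A (v |: T); apply/properP; split.
  exact: subset_trans (subsetUr _ _) s.
by exists v => //; apply: (subsetP s); rewrite setU11.
Qed.

(** The closure lies strictly above T and inside U; were it smaller than U, two strict increases of
    the rank would have to fit into one. *)
Lemma covers_closure T U (v : 'I_n) : facet_closed A T -> covers T U ->
  v \in U -> v \notin T -> facet_closure A (v |: T) = U.
Proof.
move=> cT /and3P[cU pTU /eqP rU] vU vT.
have s : facet_closure A (v |: T) \subset U.
  by apply: facet_closure_min => //; rewrite subUset sub1set vU proper_sub.
apply/eqP; rewrite eqEproper s /=; apply/negP => p.
have cV := closed_facet_closure A (v |: T).
have := rank_lt rP cT cV (setU1_facet_closure vT).
by have := rank_lt rP cV cU p; rewrite rU; lia.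
Qed.

(** Take W of rank one less between T and the closure. If W were not T, a vertex u of W outside T
    would have its closure inside W, hence of smaller cardinality. *)
Lemma covers_of_cards T (v : 'I_n) : facet_closed A T -> v \notin T ->
  (forall u, u \in facet_closure A (v |: T) -> u \notin T ->
     #|facet_closure A (u |: T)| = #|facet_closure A (v |: T)|) ->
  covers T (facet_closure A (v |: T)).
Proof.
move=> cT vT h; have cV := closed_facet_closure A (v |: T).
have p := setU1_facet_closure vT; rewrite /covers cV p /=.
have [W [cW sTW pWV ->]] := rank_graded rP cT cV p.
case: (eqVneq T W) => [-> | nTW]; first exact: eqxx.
have /properP[_ [u uW uT]] : T \proper W by rewrite properEneq nTW.
have := h u (subsetP (proper_sub pWV) _ uW) uT.
have sW : facet_closure A (u |: T) \subset W.
  by apply: facet_closure_min => //; rewrite subUset sub1set uW.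
by have := leq_ltn_trans (subset_leq_card sW) (proper_card pWV) => /ltn_eqF/eqP.
Qed.

(* L lists the faces found so far and Ar the arcs found so far; D i S tells
   that the pair consisting of the i-th face and S has been treated. *)
Record explored (L : seq {set 'I_n}) (Ar : seq (nat * nat))
    (D : nat -> {set 'I_n} -> bool) : Prop := Explored {
  explored_uniq : uniq L;
  explored_closed : forall S, S \in L -> facet_closed A S /\ r S <= k.+1;
  explored0 : set0 \in L;
  explored_uniq_arcs : uniq Ar;
  explored_arcs : forall i j, (i, j) \in Ar <-> [/\ i < size L, j < size L,
    covers (nth set0 L i) (nth set0 L j) & D i (nth set0 L j)];
  explored_covers : forall i S, i < size L -> r (nth set0 L i) <= k ->
    covers (nth set0 L i) S -> D i S -> S \in L }.

(* All pairs with i < q, and those with i = q (the face with vertex set T) where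
   the least vertex of S outside T is less than v. *)
Definition treated (q v : nat) T (i : nat) S : bool :=
  (i < q) || (i == q) && [exists w : 'I_n, (w < v) && (w \in S :\: T)].

Lemma explored_rank L Ar D i j : explored L Ar D -> i < size L -> j < size L ->
  covers (nth set0 L i) (nth set0 L j) -> r (nth set0 L i) <= k.
Proof.
move=> H li lj /and3P[_ _ /eqP e].
by have [_] := explored_closed H (mem_nth set0 lj); rewrite e.
Qed.

(** The invariant consults D only at pairs of a face of rank at most k and one of its covers, so D
    may be changed elsewhere. *)
Lemma explored_ext L Ar D D' :
  (forall i S, i < size L -> r (nth set0 L i) <= k ->
     covers (nth set0 L i) S -> D i S = D' i S) ->
  explored L Ar D -> explored L Ar D'.
Proof.
move=> e H; have [h1 h2 h3 h4 h5 h6] := H; split=> //.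
  move=> i j; rewrite h5; split=> -[li lj c d]; split=> //.
    by rewrite -e // (explored_rank H li lj c).
  by rewrite e // (explored_rank H li lj c).
by move=> i S li ri c; rewrite -e //; exact: h6.
Qed.

Lemma explored_skip_face L Ar q T T' : q < size L -> ~~ (r (nth set0 L q) <= k) ->
  explored L Ar (treated q 0 T) -> explored L Ar (treated q.+1 0 T').
Proof.
move=> lq rq; apply: explored_ext => i S li ri c; rewrite /treated.
have no (B : {set 'I_n}) : [exists w : 'I_n, (w < 0) && (w \in B)] = false.
  by apply/existsP => -[].
rewrite !no !andbF !orbF ltnS [RHS]leq_eqVlt; case: eqVneq => // e.
by move: ri; rewrite e (negPf rq).
Qed.

(** Every cover of the face has a new vertex, and all vertices are below n, so all its covers have
    been treated. *)
Lemma explored_next_face L Ar q T' : q < size L ->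
  explored L Ar (treated q n (nth set0 L q)) -> explored L Ar (treated q.+1 0 T').
Proof.
move=> lq; apply: explored_ext => i S li ri c; rewrite /treated.
have -> : [exists w : 'I_n, (w < 0) && (w \in S :\: T')] = false.
  by apply/existsP => -[].
rewrite andbF orbF ltnS [RHS]leq_eqVlt [LHS]orbC; congr (_ || _); case: eqVneq => //= e.
have /and3P[_ /properP[_ [w wS wT]] _] := c.
by apply/existsP; exists w; rewrite ltn_ord inE wS -e wT.
Qed.

Lemma treatedS q (v : 'I_n) T i S : treated q v.+1 T i S =
  treated q v T i S || (i == q) && (v \in S :\: T).
Proof.
rewrite /treated -orbA -andb_orr; congr (_ || _ && _); apply/existsP/orP.
  move=> [w /andP[]]; rewrite ltnS leq_eqVlt => /orP[/eqP/val_inj -> | lt] wS.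
    by right.
  by left; apply/existsP; exists w; rewrite lt.
case=> [/existsP[w /andP[lt wS]] | vS]; last by exists v; rewrite ltnSn.
by exists w; rewrite wS ltnW.
Qed.

Lemma treated_least q (v : 'I_n) T S : v \in S -> v \notin T ->
  ~~ treated q v T q S -> least_new T S v.
Proof.
move=> vS vT; rewrite /treated ltnn eqxx /= => /existsPn h; split=> // u uS uT.
by rewrite leqNgt; have := h u; rewrite inE uS uT !andbT.
Qed.

Lemma explored_skip_vertex L Ar q (v : 'I_n) :
  (forall S, covers (nth set0 L q) S -> ~ least_new (nth set0 L q) S v) ->
  explored L Ar (treated q v (nth set0 L q)) ->
  explored L Ar (treated q v.+1 (nth set0 L q)).
Proof.
move=> h; apply: explored_ext => i S li ri c; rewrite treatedS.
case D : (treated q v _ i S) => //=; case: eqVneq => //= e; subst i.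
apply/esym/negP; rewrite inE => /andP[vT vS].
by apply: (h S c); apply: treated_least (negbT D).
Qed.

Definition insert (L : seq {set 'I_n}) U := if U \in L then L else rcons L U.

Lemma insert_spec L U : [/\ size L <= size (insert L U), U \in insert L U,
  forall S, S \in L -> S \in insert L U &
  forall i, i < size L -> nth set0 (insert L U) i = nth set0 L i].
Proof.
rewrite /insert; case: ifP => // UL; rewrite size_rcons; split=> //.
- by rewrite mem_rcons mem_head.
- by move=> S SL; rewrite mem_rcons inE SL orbT.
- by move=> i lt; rewrite nth_rcons lt.
Qed.

(** By [covers_closure], U is the only cover of the face that contains v, so passing from v to v + 1
    treats exactly one more cover. The arc is new, since an earlier copy would come from a new
    vertex of U below v. A new U goes to the end of the list, so the indices in old arcs stay
    valid. *)
Lemma explored_emit L Ar q (v : 'I_n) U : q < size L ->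
  covers (nth set0 L q) U -> least_new (nth set0 L q) U v -> r (nth set0 L q) <= k ->
  explored L Ar (treated q v (nth set0 L q)) ->
  explored (insert L U) (rcons Ar (q, index U (insert L U)))
    (treated q v.+1 (nth set0 L q)).
Proof.
set T := nth set0 L q; move=> lq cTU lv rT H; have [h1 h2 h3 h4 h5 h6] := H.
have [vU vT vmin] := lv; have [cT _] := h2 _ (mem_nth set0 lq).
have [L'1 L'2 L'3 L'4] := insert_spec L U.
have uL' : uniq (insert L U).
  by rewrite /insert; case: ifP => // UL; rewrite rcons_uniq UL.
have cL' S : S \in insert L U -> facet_closed A S /\ r S <= k.+1.
  rewrite /insert; case: ifP => _; first exact: h2.
  rewrite mem_rcons inE => /predU1P[-> | ]; last exact: h2.
  by have /and3P[cU _ /eqP ->] := cTU.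
have UE S : covers T S -> v \in S :\: T -> S = U.
  rewrite inE => c /andP[_ vS].
  by rewrite -(covers_closure cT c vS vT) (covers_closure cT cTU).
have bound i S : treated q v.+1 T i S -> i < size L.
  by case/orP => [/ltn_trans -> // | /andP[/eqP -> _]].
split=> //; first exact: L'3.
- rewrite rcons_uniq h4 andbT; apply/negP => /h5 [_ lj _].
  rewrite -(L'4 _ lj) nth_index // /treated ltnn eqxx /= => /existsP[w /andP[wv]].
  by rewrite inE => /andP[wT wU]; have := vmin w wU wT; rewrite leqNgt wv.
- move=> i j; rewrite mem_rcons inE; split.
    move=> /predU1P[[-> ->] | /h5[li lj c d]].
      rewrite index_mem L'2 (leq_trans lq) // nth_index // L'4 //; split=> //.
      by rewrite treatedS eqxx inE vU vT orbT.
    by rewrite !(leq_trans _ L'1) // !L'4 // treatedS d.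
  move=> [_ lj c d]; have li := bound _ _ d; rewrite L'4 // in c.
  set S := nth set0 (insert L U) j in c d.
  have SL : S \in insert L U by exact: mem_nth.
  have ri : r (nth set0 L i) <= k.
    by have [_] := cL' _ SL; have /and3P[_ _ /eqP ->] := c.
  move: d; rewrite treatedS => /orP[d | /andP[/eqP e vS]]; last first.
    subst i; apply/orP; left; apply/eqP; congr (_, _).
    by rewrite -[X in index X _](UE S c vS) index_uniq.
  (* Covers treated before are already in L, so j is not the place of a newly appended U. *)
  have SL' := h6 i S li ri c d.
  have ej : j = index S L.
    apply/eqP; have lt : index S L < size (insert L U).
      by rewrite (leq_trans _ L'1) // index_mem.
    by rewrite -(nth_uniq set0 lj lt uL') (L'4 (index S L)) ?index_mem // nth_index.
  by apply/orP; right; apply/h5; rewrite ej index_mem nth_index.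
move=> i S li' ri c d; have li := bound _ _ d; rewrite L'4 // in ri c.
move: d; rewrite treatedS => /orP[d | /andP[/eqP e vS]].
  by apply: L'3; exact: h6 c d.
by subst i; rewrite (UE S c vS).
Qed.

(** Induction on the rank: gradedness above the empty set gives W one rank below S; W is listed by
    induction, and since all pairs are treated, so is its cover S. *)
Lemma explored_complete L Ar T : explored L Ar (treated (size L) 0 T) ->
  forall S, S \in L <-> facet_closed A S /\ r S <= k.+1.
Proof.
move=> H S; split; first exact: (explored_closed H).
move=> []; have [l] := ubnP (r S); elim: l S => // l IH S rl cS rS.
have [-> | S0] := eqVneq S set0; first exact: (explored0 H).
have [] := rank_graded rP (closed0 rP) cS; first by rewrite proper0.
move=> W [cW _ pWS e].
have WL : W \in L by apply: IH => //; lia.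
have li : index W L < size L by rewrite index_mem.
apply: (explored_covers H li); rewrite ?nth_index //.
- by lia.
- by rewrite /covers cS pWS e eqxx.
- by rewrite /treated li.
Qed.

(** * Correctness of the exploration *)

(** [repr_ids] ranges over all vertex sets, because a zero at the address of a set must certify that
    it is new; insertion preserves this since [set_code] is injective. *)
Record represents (s : state) (L : seq {set 'I_n}) (Ar : seq (nat * nat)) : Prop :=
  Represents {
  repr_nodes : var s vNodes = size L;
  repr_end : var s vEnd = size L * n;
  repr_num_arcs : var s vArcs = size Ar;
  repr_faces : forall i u, i < size L -> u < n ->
    arr s aFace (i * n + u) = chi (nth set0 L i) u;
  repr_ranks : forall i, i < size L -> arr s aRank i = r (nth set0 L i);
  repr_ids : forall S,
    arr s aId (set_code S) = if S \in L then (index S L).+1 else 0;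
  repr_arcs : forall e, e < size Ar ->
    arr s aTail e = (nth (0, 0) Ar e).1 /\ arr s aHead e = (nth (0, 0) Ar e).2 }.

Lemma represents_same p s s' L Ar : same p s s' ->
  ~~ has (mem (written_vars p)) [:: vNodes; vEnd; vArcs] ->
  ~~ has (mem (written_arrs p)) [:: aTail; aHead; aFace; aRank; aId] ->
  represents s L Ar -> represents s' L Ar.
Proof.
move=> [sv sa] /hasPn hv /hasPn ha [h1 h2 h3 h4 h5 h6 h7].
split; rewrite ?sv //; try by apply: hv.
- by move=> i u li lu; rewrite sa ?h4 //; apply: ha.
- by move=> i li; rewrite sa ?h5 //; apply: ha.
- by move=> S; rewrite sa ?h6 //; apply: ha.
- by move=> e /h7[h8 h9]; rewrite !sa //; apply: ha.
Qed.

Lemma compute_cards_runs s T : loaded s ->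
  (forall u, u < n -> arr s aFace (var s vQn + u) = chi T u) ->
  runs compute_cards s (n * (closure_time + 28) + 6) (fun s' =>
    forall u : 'I_n, u \notin T -> arr s' aCard u = #|facet_closure A (u |: T)|).
Proof.
move=> ls sT; have [_ sN _ _] := ls.
apply: (@runs_weaken _ _ (n * (closure_time + 20 + 8) + 6) _ (fun s' =>
  forall u : 'I_n, u < n -> u \notin T ->
    arr s' aCard u = #|facet_closure A (u |: T)|)); [|lia|]; last first.
  by move=> s' _ h u; apply: h.
apply: (@runs_for _ _ _ _ _ _ (fun j s' => forall u : 'I_n, u < j -> u \notin T ->
    arr s' aCard u = #|facet_closure A (u |: T)|)) => //.
move=> j s1 jn sj fr I; have ls1 := loaded_same fr isT isT ls.
have f1 := fr.1 vQn isT; have s1T u : u < n -> arr s1 aFace (var s1 vQn + u) = chi T u.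
  by move=> lt; rewrite f1 (fr.2 aFace _ isT) sT.
apply: runs_if => /=; [lia | |]; rewrite sj s1T // -[j]/(val (Ordinal jn)) chiE => jT.
  apply: runs_skip => //; first by rewrite /=; lia.
  move=> u /=; rewrite ltnS leq_eqVlt => /orP[/eqP e | lt]; last exact: I.
  by have -> : u = Ordinal jn by [apply: val_inj]; move: jT; case: (_ \in T).
have {}jT : Ordinal jn \notin T by move: jT; case: (_ \in T).
apply: (@runs_weaken _ _ (closure_time + 3) _ (fun s2 =>
  forall u : 'I_n, u < j.+1 -> u \notin T ->
    arr s2 aCard u = #|facet_closure A (u |: T)|)) => //; last by rewrite /=; lia.
apply: runs_seq; first exact: (@compute_closure_runs s1 T (Ordinal jn)).
move=> s2 fr2 [c2 _ _]; apply: runs_store => //= u.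
have f3 := fr2.1 vV isT; rewrite f3 sj ltnS leq_eqVlt.
case: eqVneq => [e _ _ | _ /= lt uT].
  by have -> : u = Ordinal jn by [apply: val_inj].
by rewrite (fr2.2 aCard u isT) I.
Qed.

(** A conjunction in arithmetic: the right side is 2 if u is new and 0 otherwise, so the inequality
    says that u is new and one of the two conditions on the left fails. At a vertex of T a stale
    cell of [card] cannot trigger it. *)
Definition bad_witness (card : nat -> nat) T U (v u : nat) : bool :=
  ((card u == #|U|) + (v <= u) < (chi T u < chi U u) + (chi T u < chi U u)).

Lemma test_cover_runs s T U : var s vN = n ->
  (forall u, u < n -> arr s aFace (var s vQn + u) = chi T u) ->
  (forall u, u < n -> arr s aClosure u = chi U u) ->
  var s vSize = #|U| ->
  runs test_cover s (n * 38 + 10) (fun s' =>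
    var s' vBad = \sum_(0 <= u < n) bad_witness (arr s aCard) T U (var s vV) u).
Proof.
move=> sN sT sU sz; apply: runs_seq_assign; first by rewrite /=; lia.
set s0 := set_var _ _ _.
have H := @runs_for vU vN _ s0 n 30 (fun j s1 =>
  var s1 vBad = \sum_(0 <= u < j) bad_witness (arr s aCard) T U (var s vV) u).
apply: (runs_weaken (H _ _ _ _ _ _)) => //=; last by lia.
  by rewrite big_geq.
move=> j s1 jn sj fr I; apply: runs_assign => //=.
have f1 := fr.1 vQn isT; have f2 := fr.2 aFace (var s vQn + j) isT.
have f3 := fr.2 aClosure j isT; have f4 := fr.2 aCard j isT.
have f5 := fr.1 vSize isT; have f6 := fr.1 vV isT.
rewrite /= in f1 f2 f3 f4 f5 f6.
by rewrite big_nat_recr //= I sj f1 f2 f3 f4 f5 f6 sT // sU // sz.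
Qed.

Lemma bad_witness_eq0 card T U (v : 'I_n) :
  (\sum_(0 <= u < n) bad_witness card T U v u == 0) =
  [forall u : 'I_n, (u \in U) ==> (u \notin T) ==> (card u == #|U|) && (v <= u)].
Proof.
rewrite big_mkord sum_nat_eq0; apply: eq_forallb => u.
rewrite implyTb /bad_witness !chiE.
by case: (u \in U); case: (u \in T); case: (card u == #|U|); case: (v <= u).
Qed.

Definition emit_time : nat := n * 18 + 60.

Lemma insert_face_runs s L Ar q U : loaded s -> represents s L Ar ->
  q < size L -> var s vQ = q -> U \notin L -> r U = (r (nth set0 L q)).+1 ->
  (forall u, u < n -> arr s aClosure u = chi U u) -> var s vCode = set_code U ->
  runs insert_face s (n * 18 + 40) (fun s' => represents s' (rcons L U) Ar).
Proof.
move=> [_ sN _ _] [h1 h2 h3 h4 h5 h6 h7] lq sq UL rU sU sc.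
apply: runs_seq_store; first by rewrite /=; lia.
apply: runs_seq_store; first by rewrite /=; lia.
set s0 := set_arr _ _ _ _.
apply: (@runs_weaken _ _ ((n * (10 + 8) + 6) + 8) _
  (fun s' => represents s' (rcons L U) Ar)) => //; last by rewrite /=; lia.
apply: (@runs_seq _ _ _ _ _ (fun s1 =>
  (forall u, u < n -> arr s1 aFace (size L * n + u) = chi U u) /\
  (forall p, p < size L * n -> arr s1 aFace p = arr s aFace p))).
  apply: (@runs_for _ _ _ _ _ _ (fun j s1 =>
    (forall u, u < j -> arr s1 aFace (size L * n + u) = chi U u) /\
    (forall p, p < size L * n -> arr s1 aFace p = arr s aFace p))) => //.
  move=> j s1 jn sj fr [I1 I2]; apply: runs_store => //=.
  have f1 := fr.1 vEnd isT; have f2 := fr.2 aClosure j isT; rewrite /= in f1 f2.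
  rewrite sj f1 f2 sU // h2; split=> [u | p lt].
    rewrite eqn_add2l ltnS leq_eqVlt; case: eqVneq => [-> // | _ /=]; exact: I1.
  by rewrite ltn_eqF ?I2 // ltn_addr.
move=> s1 fr1 [F1 F2]; apply: runs_seq_assign => //; apply: runs_assign => //.
have g1 := fr1.1 vNodes isT; have g2 := fr1.1 vEnd isT; have g3 := fr1.1 vN isT.
have g4 := fr1.1 vArcs isT; rewrite /= in g1 g2 g3 g4.
split=> /=.
- by rewrite g1 h1 size_rcons addn1.
- by rewrite g2 g3 h2 sN size_rcons mulSn addnC.
- by rewrite g4.
- move=> i u; rewrite size_rcons ltnS nth_rcons leq_eqVlt => /orP[/eqP -> | lt] lu.
    by rewrite ltnn eqxx F1.
  rewrite lt F2 ?h4 //; apply: leq_trans (_ : i.+1 * n <= _).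
    by rewrite mulSn addnC ltn_add2r.
  by rewrite leq_mul2r lt orbT.
- move=> i; have g5 := fr1.2 aRank i isT; rewrite /= in g5.
  rewrite g5 size_rcons ltnS nth_rcons leq_eqVlt h1 sq => /orP[/eqP -> | lt].
    by rewrite ltnn eqxx rU addn1 h5.
  by rewrite lt ltn_eqF ?h5.
- move=> S; have g6 := fr1.2 aId (set_code S) isT; rewrite /= in g6.
  rewrite g6 sc (inj_eq set_code_inj) mem_rcons inE -cats1 index_cat h1.
  case: eqVneq => [-> | nSU]; first by rewrite (negPf UL) /= eqxx addn0 addn1.
  by rewrite /= h6; case: (S \in L).
- by move=> e /h7[h8 h9]; rewrite (fr1.2 aTail e isT) (fr1.2 aHead e isT).
Qed.

Lemma emit_cover_runs s L Ar q U : loaded s -> represents s L Ar ->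
  q < size L -> var s vQ = q -> r U = (r (nth set0 L q)).+1 ->
  (forall u, u < n -> arr s aClosure u = chi U u) -> var s vCode = set_code U ->
  runs emit_cover s emit_time (fun s' =>
    represents s' (insert L U) (rcons Ar (q, index U (insert L U)))).
Proof.
move=> ls rs lq sq rU sU sc.
apply: (@runs_weaken _ _ ((n * 18 + 44) + 16) _ (fun s' =>
    represents s' (insert L U) (rcons Ar (q, index U (insert L U)))));
  [| by rewrite /emit_time; lia | by []].
apply: (@runs_seq _ _ _ _ _ (fun s1 => represents s1 (insert L U) Ar)).
  apply: runs_if => /=; first by lia.
    rewrite sc (repr_ids rs) /insert => h; apply: runs_skip; first by lia.
    by case: ifP h => //; rewrite eqxx.
  rewrite sc (repr_ids rs) /insert; case: ifP => // /negbT UL _.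
  apply: runs_weaken (insert_face_runs ls rs lq sq UL rU sU sc) _ _ => //.
  lia.
move=> s1 fr1 [h1 h2 h3 h4 h5 h6 h7].
apply: runs_seq_store => //; apply: runs_seq_store => //; apply: runs_assign => //.
have [_ UL' _ _] := insert_spec L U.
have g1 := fr1.1 vQ isT; have g2 := fr1.1 vCode isT.
split=> //=; first by rewrite h3 size_rcons addn1.
move=> e; rewrite size_rcons ltnS h3 g1 g2 sq sc h6 UL' subn1 nth_rcons.
rewrite leq_eqVlt => /orP[/eqP -> | lt]; first by rewrite ltnn eqxx.
by rewrite ltn_eqF // lt; exact: h7.
Qed.

Lemma emit_covers_runs s L Ar q : loaded s -> represents s L Ar ->
  q < size L -> var s vQ = q -> var s vQn = q * n -> r (nth set0 L q) <= k ->
  (forall u : 'I_n, u \notin nth set0 L q ->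
     arr s aCard u = #|facet_closure A (u |: nth set0 L q)|) ->
  explored L Ar (treated q 0 (nth set0 L q)) ->
  runs emit_covers s (n * (closure_time + n * 56 + 108) + 6) (fun s' =>
    exists L' Ar', [/\ represents s' L' Ar', q < size L' &
      explored L' Ar' (treated q n (nth set0 L' q))]).
Proof.
set T := nth set0 L q; move=> ls rs lq sq sqn rT sC xL; have [_ sN _ _] := ls.
(* The list may grow during the loop, but only at its end, so its entry at q remains T. *)
pose Inv j (s' : state) := exists L' Ar', [/\ represents s' L' Ar', q < size L',
  nth set0 L' q = T & explored L' Ar' (treated q j T)].
apply: (@runs_weaken _ _ (n * (closure_time + n * 56 + 100 + 8) + 6) _ (Inv n));
  [| lia |]; last first.
  by move=> s' _ [L' [Ar' [h1 h2 h3 h4]]]; exists L', Ar'; rewrite h3.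
apply: runs_for => //; first by exists L, Ar; split=> //; case: rs; split.
move=> j s1 jn sj fr [L1 [Ar1 [rs1 lq1 T1 x1]]].
have ls1 := loaded_same fr isT isT ls; have [_ s1N _ _] := ls1.
have s1q := fr.1 vQ isT; have s1qn := fr.1 vQn isT; rewrite sq in s1q; rewrite sqn in s1qn.
have s1T u : u < n -> arr s1 aFace (var s1 vQn + u) = chi T u.
  by move=> lt; rewrite s1qn (repr_faces rs1) // T1.
pose v := Ordinal jn.
have cT : facet_closed A T by have [] := explored_closed xL (mem_nth set0 lq).
have skip s2 : represents s2 L1 Ar1 ->
    (forall S, covers T S -> ~ least_new T S v) -> Inv j.+1 (set_var s2 vV j.+1).
  move=> rs2 h; exists L1, Ar1; split=> //; first by case: rs2; split.
  by rewrite -T1; apply: (explored_skip_vertex (v := v)); rewrite T1.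
apply: runs_if => /=; [lia | |]; rewrite sj s1T // -[j]/(val v) chiE => jT.
  apply: runs_skip; first by lia.
  by apply: skip => // S _ [_ vT _]; move: jT; rewrite (negbTE vT).
have {}jT : v \notin T by move: jT; case: (_ \in T).
set U := facet_closure A (v |: T).
apply: (@runs_weaken _ _ (closure_time + ((n * 38 + 10) + (emit_time + 10))) _
  (fun s2 => Inv j.+1 (set_var s2 vV j.+1))) => //; last first.
  by rewrite /emit_time; lia.
apply: runs_seq; first exact: (@compute_closure_runs s1 T v).
move=> s2 fr2 [sz2 code2 clo2].
have ls2 := loaded_same fr2 isT isT ls1; have [_ s2N _ _] := ls2.
have rs2 := represents_same fr2 isT isT rs1.
have s2v := fr2.1 vV isT; rewrite sj in s2v.
have s2q := fr2.1 vQ isT; rewrite s1q in s2q.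
apply: runs_seq.
  apply: (@test_cover_runs s2 T U) => // u lt.
  by rewrite (fr2.1 vQn isT) (fr2.2 aFace _ isT) s1T.
move=> s3 fr3; rewrite s2v => bad3.
have ls3 := loaded_same fr3 isT isT ls2; have rs3 := represents_same fr3 isT isT rs2.
have card2 (u : 'I_n) : u \notin T -> arr s2 aCard u = #|facet_closure A (u |: T)|.
  by move=> uT; rewrite (fr2.2 aCard u isT) (fr.2 aCard u isT) sC.
(* The test is exact: equal cardinalities give a cover by [covers_of_cards], and by [covers_closure]
   all new vertices of a cover have the same closure. *)
have okE : (var s3 vBad == 0) <-> covers T U /\ least_new T U v.
  rewrite bad3 -[j]/(val v) bad_witness_eq0; split.
    move=> /forallP h; have {}h u : u \in U -> u \notin T ->
        #|facet_closure A (u |: T)| = #|U| /\ v <= u.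
      by move=> uU uT; have := h u; rewrite uU uT card2 // => /andP[/eqP -> ->].
    split; first by apply: covers_of_cards => // u uU uT; case: (h u uU uT).
    split=> //; last by move=> u uU uT; case: (h u uU uT).
    by apply: (subsetP (subset_facet_closure _ _)); rewrite setU11.
  move=> [c [vU _ vmin]]; apply/forallP => u; apply/implyP => uU; apply/implyP => uT.
  by rewrite card2 // (covers_closure cT c uU uT) eqxx vmin.
apply: runs_if => /=; first by lia.
  case E : (var s3 vBad == 0) => // _; have [cU lU] := okE.1 E.
  have := @emit_cover_runs s3 L1 Ar1 q U ls3 rs3 lq1.
  rewrite (fr3.1 vQ isT) s2q T1 => /(_ erefl) H.
  apply: (@runs_weaken _ _ _ _ _ _ (H _ _ _)).
  - by case/and3P: cU => _ _ /eqP.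
  - by move=> u lt; rewrite (fr3.2 aClosure u isT) clo2.
  - by rewrite (fr3.1 vCode isT).
  - by lia.
  move=> s4 fr4 rs4; have [L2 _ _ L2n] := insert_spec L1 U.
  exists (insert L1 U), (rcons Ar1 (q, index U (insert L1 U))); split=> //.
  - by case: rs4; split.
  - exact: leq_trans lq1 L2.
  - by rewrite L2n.
  - by rewrite -T1; apply: (explored_emit (v := v)); rewrite ?T1.
case E : (var s3 vBad == 0) => // _; apply: runs_skip; first by lia.
(* A cover with least new vertex v would be the closure of T + v, which the test accepts. *)
apply: skip => // S cS lS; suff : var s3 vBad == 0 by rewrite E.
apply/okE.
have [vS vT _] := lS.
by rewrite /U (covers_closure cT cS vS vT).
Qed.

Definition num_closed : nat := #|[set S | facet_closed A S && (r S <= k.+1)]|.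

Lemma explored_size L Ar D : explored L Ar D -> size L <= num_closed.
Proof.
move=> H; rewrite /num_closed cardE; apply: uniq_leq_size (explored_uniq H) _.
by move=> S /(explored_closed H)[cS rS]; rewrite mem_enum inE cS.
Qed.

Definition step_time : nat :=
  (n * (closure_time + 28) + 6) + (n * (closure_time + n * 56 + 108) + 6) + 30.

(** No vertex is below 0, so the set argument is a dummy here; the main loop uses [set0]. *)
Lemma explored_treated0 L Ar q T T' :
  explored L Ar (treated q 0 T) -> explored L Ar (treated q 0 T').
Proof.
have no (B : {set 'I_n}) : [exists w : 'I_n, (w < 0) && (w \in B)] = false.
  by apply/existsP => -[].
by apply: explored_ext => i S _ _ _; rewrite /treated !no.
Qed.

(** Each round advances q, and L never has more than [num_closed] entries; so [num_closed - q]
    bounds the remaining rounds although L grows meanwhile. *)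
Lemma explore_runs s L Ar q : loaded s -> var s vK = k -> represents s L Ar ->
  q <= size L -> var s vQ = q -> var s vQn = q * n ->
  explored L Ar (treated q 0 set0) ->
  runs explore s ((num_closed - q) * step_time + 4) (fun s' =>
    exists L' Ar', represents s' L' Ar' /\
      explored L' Ar' (treated (size L') 0 set0)).
Proof.
move Dl: (num_closed - q) => l.
elim: l q s L Ar Dl => [|l IH] q s L Ar Dl ls sk rs qL sq sqn xL.
  have sL := explored_size xL; have eq : q = size L by lia.
  exists 4, s; split=> //; last by exists L, Ar; rewrite -eq.
  apply: (ExecWhileFalse (e := Bin Lt (Var vQ) (Var vNodes))).
  by rewrite /= sq (repr_nodes rs) eq ltnn.
move: qL; rewrite leq_eqVlt => /orP[/eqP eq | lq].
  exists 4, s; split; [| lia | by exists L, Ar; rewrite -eq].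
    apply: (ExecWhileFalse (e := Bin Lt (Var vQ) (Var vNodes))).
    by rewrite /= sq (repr_nodes rs) eq ltnn.
have [_ sN _ _] := ls.
(* The 4 units set aside pay for the loop test. *)
have [t1 [s1 [ex1 le1 [L1 [Ar1 [rs1 lq1 sq1 sqn1 x1]]]]]] : runs explore_face s (step_time - 4)
    (fun s' => exists L' Ar', [/\ represents s' L' Ar', q.+1 <= size L',
      var s' vQ = q.+1, var s' vQn = q.+1 * n & explored L' Ar' (treated q.+1 0 set0)]).
  apply: (@runs_weaken _ _ ((n * (closure_time + 28) + 6) +
    (n * (closure_time + n * 56 + 108) + 6) + 10 + 12) _
    (fun s' => exists L' Ar', [/\ represents s' L' Ar', q.+1 <= size L',
      var s' vQ = q.+1, var s' vQn = q.+1 * n & explored L' Ar' (treated q.+1 0 set0)]))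
    => //; last by rewrite /step_time; lia.
  apply: (@runs_seq _ _ _ _ _ (fun s1 => exists L' Ar', [/\ represents s1 L' Ar',
      q < size L' & explored L' Ar' (treated q.+1 0 set0)])); last first.
    move=> s1 fr1 [L' [Ar' [rs' lq' x']]].
    apply: runs_seq_assign => //; apply: runs_assign => //; exists L', Ar'.
    have f1 := fr1.1 vQ isT; have f2 := fr1.1 vQn isT; have f3 := fr1.1 vN isT.
    split=> //=; first by case: rs'.
      by rewrite f1 sq addn1.
    by rewrite f2 f3 sqn sN mulSn addnC.
  have sF u : u < n -> arr s aFace (var s vQn + u) = chi (nth set0 L q) u.
    by move=> lt; rewrite sqn (repr_faces rs).
  apply: runs_if => /=; first by lia.
    rewrite sq (repr_ranks rs) // sk; case: leqP => // rk _.
    apply: (@runs_weaken _ _ ((n * (closure_time + 28) + 6) +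
      (n * (closure_time + n * 56 + 108) + 6)) _ (fun s1 => exists L' Ar',
      [/\ represents s1 L' Ar', q < size L' &
       explored L' Ar' (treated q.+1 0 set0)])) => //; last by lia.
    apply: runs_seq; first exact: compute_cards_runs ls sF.
    move=> s1 fr1 card1; have ls1 := loaded_same fr1 isT isT ls.
    have rs1 := represents_same fr1 isT isT rs.
    have q1 : var s1 vQ = q by rewrite (fr1.1 vQ isT).
    have qn1 : var s1 vQn = q * n by rewrite (fr1.1 vQn isT).
    have H := emit_covers_runs ls1 rs1 lq q1 qn1 rk card1
      (explored_treated0 (nth set0 L q) xL).
    apply: (runs_weaken H) => //.
    move=> s2 _ [L' [Ar' [h1 h2 h3]]]; exists L', Ar'; split=> //.
    exact: explored_next_face h3.
  rewrite sq (repr_ranks rs) // sk; case: leqP => // rk _.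
  apply: runs_skip; first by lia.
  exists L, Ar; split=> //; apply: (explored_skip_face (T := set0)) => //.
  by rewrite -ltnNge.
have fr := exec_same ex1.
have [||| t2 [s2 [ex2 le2 H2]]] := IH q.+1 s1 L1 Ar1 _ _ _ rs1 lq1 sq1 sqn1 x1.
- by lia.
- exact: loaded_same fr isT isT ls.
- by rewrite (fr.1 vK isT).
exists ((3 + t1 + t2).+1), s2; split=> //.
  apply: (ExecWhileTrue (e := Bin Lt (Var vQ) (Var vNodes)) _ ex1 ex2).
  by rewrite /= sq (repr_nodes rs) lq.
have : 30 <= step_time by rewrite /step_time leq_addl.
rewrite mulSn; lia.
Qed.

(** * Reading the matrix and the complete run *)

Definition reading (t : nat) (s : state) : Prop :=
  [/\ var s vPos = t, var s vInc = size (edges t) &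
   forall e, e < size (edges t) ->
     arr s aFacet e = (nth (0, 0) (edges t) e).1 /\
     arr s aVertex e = (nth (0, 0) (edges t) e).2].

Lemma edgesS t : edges t.+1 =
  if incident t then rcons (edges t) (t %/ n, t %% n) else edges t.
Proof.
rewrite /edges -addn1 iotaD filter_cat map_cat /=.
by case: (incident t); rewrite ?cats0 ?cats1.
Qed.

Lemma read_matrix_runs s : var s vM = m -> var s vN = n ->
  (forall p, arr s 0 p = incident p) -> var s vPos = 0 -> var s vInc = 0 ->
  runs read_matrix s (m * (n * 28 + 14) + 6) loaded.
Proof.
move=> sM sN sA pos0 inc0.
apply: (@runs_weaken _ _ (m * ((n * 28 + 6) + 8) + 6) _ (reading (m * n)));
  [| by lia | by move=> s' fr [h1 h2 h3]; split;
     rewrite ?(fr.1 vM isT) ?(fr.1 vN isT)].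
apply: (@runs_for _ _ _ _ _ _ (fun j s1 => reading (j * n) s1)) => //.
move=> f s1 fm s1f fr1 I1.
apply: (@runs_weaken _ _ (n * (20 + 8) + 6) _ (fun s2 => reading (f * n + n) s2));
  [| by lia | by move=> s' _ [h1 h2 h3]; rewrite mulSn addnC; split].
apply: (@runs_for _ _ _ _ _ _ (fun v s2 => reading (f * n + v) s2)) => //.
- by rewrite (fr1.1 vN isT).
- by rewrite addn0; case: I1.
move=> v s2 vn s2v fr2 [h1 h2 h3].
have s2A : arr s2 0 (f * n + v) = incident (f * n + v).
  by rewrite (fr2.2 0 _ isT) (fr1.2 0 _ isT) sA.
apply: (@runs_seq _ _ _ 16 4 (fun s3 => [/\ var s3 vPos = f * n + v,
   var s3 vInc = size (edges (f * n + v).+1) &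
   forall e, e < size (edges (f * n + v).+1) ->
     arr s3 aFacet e = (nth (0, 0) (edges (f * n + v).+1) e).1 /\
     arr s3 aVertex e = (nth (0, 0) (edges (f * n + v).+1) e).2])); last first.
  move=> s3 fr3 [g1 g2 g3]; apply: runs_assign => //; rewrite addnS.
  by split=> //=; rewrite g1 addn1.
rewrite edgesS; apply: runs_if => //=; rewrite h1 s2A; case: (incident _) => // _;
  last exact: runs_skip.
apply: runs_seq_store => //; apply: runs_seq_store => //; apply: runs_assign => //.
have e1 := pos_divmod f (Ordinal vn); rewrite /= in e1.
have s2f := fr2.1 vF isT; rewrite s1f in s2f.
rewrite !e1; split=> //=; first by rewrite h2 size_rcons addn1.
move=> e; rewrite size_rcons ltnS nth_rcons h2 s2f s2v leq_eqVlt.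
case/orP=> [/eqP -> | lt]; first by rewrite ltnn eqxx.
by rewrite ltn_eqF // lt; exact: h3.
Qed.

Lemma explored_init : explored [:: set0] [::] (treated 0 0 set0).
Proof.
split=> //.
- move=> S; rewrite inE => /eqP ->; split; first exact: closed0 rP.
  by rewrite (rank0 rP).
- exact: mem_head.
- by move=> i j; rewrite in_nil; split=> // -[_ _ _]; rewrite /treated => /andP[_ /existsP[]].
- by move=> i S _ _ _; rewrite /treated => /andP[_ /existsP[]].
Qed.

Definition total_time : nat :=
  (m * (n * 28 + 14) + 6) + (num_closed * step_time + 4) + 30.

Lemma skeleton_prog_runs : runs skeleton_prog (input A k) total_time (fun s =>
  exists L Ar, [/\ output_nodes s = size L, output_arcs s = Ar &
    explored L Ar (treated (size L) 0 set0)]).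
Proof.
apply: (@runs_weaken _ _ ((m * (n * 28 + 14) + 6) +
  (20 + ((num_closed * step_time + 4) + 10))) _ (fun s =>
  exists L Ar, [/\ output_nodes s = size L, output_arcs s = Ar &
    explored L Ar (treated (size L) 0 set0)])) => //; last by rewrite /total_time; lia.
apply: runs_seq; first by apply: read_matrix_runs.
move=> s1 fr1 ls1; have [_ s1N _ _] := ls1.
apply: runs_seq_store; first by rewrite /=; lia.
apply: runs_seq_assign; first by rewrite /=; lia.
apply: runs_seq_assign; first by rewrite /=; lia.
set s2 := set_var _ _ _.
apply: (@runs_weaken _ _ ((num_closed * step_time + 4) + 10) _ (fun s =>
  exists L Ar, [/\ output_nodes s = size L, output_arcs s = Ar &
    explored L Ar (treated (size L) 0 set0)])) => //; last by rewrite /=; lia.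
have rs2 : represents s2 [:: set0] [::].
  split=> //=.
  - by rewrite s1N mul1n.
  - by rewrite (fr1.1 vArcs isT).
  - case=> // u _ un; rewrite (fr1.2 aFace _ isT) /= -[u]/(val (Ordinal un)) chiE.
    by rewrite inE.
  - by case=> // _; rewrite (fr1.2 aRank _ isT) (rank0 rP).
  - move=> S; rewrite inE -[S == _](inj_eq set_code_inj) set_code0 (fr1.2 aId _ isT) /=.
    by rewrite [set0 == S]eq_sym -[S == _](inj_eq set_code_inj) set_code0; case: eqP.
apply: runs_seq.
  have := @explore_runs s2 [:: set0] [::] 0; rewrite subn0; apply=> //.
  - by rewrite /= (fr1.1 vK isT).
  - by rewrite /= (fr1.1 vQ isT).
  - by rewrite /= (fr1.1 vQn isT).
  - exact: explored_init.
move=> s3 fr3 [L [Ar [rs3 xL]]]; apply: runs_seq_assign => //; apply: runs_assign => //.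
exists L, Ar; rewrite /output_nodes /output_arcs /= (repr_nodes rs3).
rewrite (repr_num_arcs rs3); split=> //.
apply: (@eq_from_nth _ (0, 0)) => [|e]; rewrite size_map size_iota // => lt.
have [h1 h2] := repr_arcs rs3 lt.
rewrite (nth_map 0) ?size_iota // nth_iota // add0n h1 h2.
by case: (nth _ _ _).
Qed.

(** * Estimates of the running time *)

Lemma num_closed_gt0 : 0 < num_closed.
Proof.
apply/card_gt0P; exists set0.
by rewrite inE (closed0 rP) (rank0 rP).
Qed.

Lemma num_closed_le : num_closed <= 2 ^ n.
Proof.
apply: leq_trans (max_card _) _.
by rewrite -cardsT -powersetT card_powerset cardsT card_ord.
Qed.

(** Serves the cases in which alpha may vanish: there are at most 2^n <= 2 closed sets, so the time
    is bounded by a constant. *)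
Lemma total_time_small : m <= 1 -> n <= 1 -> total_time <= 3000.
Proof.
move=> m1 n1; have N2 : num_closed <= 2.
  apply: leq_trans num_closed_le _.
  by apply: leq_trans (_ : 2 ^ 1 <= _); rewrite ?leq_exp2l.
have a1 : size incidences <= 1.
  rewrite size_incidences; apply: leq_trans (max_card _) _.
  by rewrite card_prod !card_ord; case: m m1 => [|[]] // _; case: n n1 => [|[]].
have c1 : closure_time <= 170 by rewrite /closure_time; lia.
have s1 : step_time <= 600.
  rewrite /step_time; set x := n * _; set y := n * (_ + _).
  have hx : x <= 1 * (170 + 28) by rewrite leq_mul // leq_add2r.
  have hy : y <= 1 * (170 + 1 * 56 + 108).
    by rewrite leq_mul // leq_add2r leq_add // leq_mul2r n1 orbT.
  lia.
rewrite /total_time.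
have h1 : m * (n * 28 + 14) <= 1 * (1 * 28 + 14).
  by rewrite leq_mul // leq_add2r leq_mul2r n1 orbT.
have h2 : num_closed * step_time <= 2 * 600 by rewrite leq_mul.
lia.
Qed.

(** As 1, m, n <= alpha, a closure costs at most 56 + 26 + 38 + 50 = 170 times alpha, and a face at
    most 198 + 334 + 42 <= 600 times n alpha. Reading the matrix adds 42 n alpha, so 3000 is
    generous. *)
Lemma total_time_large : 0 < n -> m <= size incidences -> n <= size incidences ->
  total_time <= 3000 * (n * size incidences * num_closed).
Proof.
set a := size incidences => n0 ma na; have a0 : 0 < a by exact: leq_trans na.
have N0 := num_closed_gt0.
have c1 : closure_time <= 170 * a by rewrite /closure_time -/a; lia.
have na_ge : a <= n * a by rewrite leq_pmull.
have s1 : step_time <= 600 * (n * a).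
  rewrite /step_time.
  have hx : n * (closure_time + 28) <= n * (198 * a) by rewrite leq_mul2l; lia.
  have hy : n * (closure_time + n * 56 + 108) <= n * (334 * a) by rewrite leq_mul2l; lia.
  lia.
have h1 : m * (n * 28 + 14) <= a * (n * 42) by rewrite leq_mul //; lia.
have h2 : num_closed * step_time <= num_closed * (600 * (n * a)) by rewrite leq_mul2l s1 orbT.
have h3 : n * a <= n * a * num_closed by rewrite leq_pmulr.
rewrite /total_time; lia.
Qed.

End Correctness.

(** * Faces of polyhedra given by inequalities *)

From mathcomp Require Import finmap.
From mathcomp Require Import boolp classical_sets cardinality reals.
From mathcomp Require Import fintype finset ring lra.

Import Order.TTheory GRing.Theory Num.Theory.

Section MulmxEntry.
Local Open Scope ring_scope.
Variables (R : realType) (q d : nat) (M : 'M[R]_(q, d)).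
Implicit Types x y u : 'cV[R]_d.

Lemma mulmx_line x (t : R) u i :
  (M *m (x + t *: u)) i 0 = (M *m x) i 0 + t * (M *m u) i 0.
Proof. by rewrite mulmxDr -scalemxAr !mxE. Qed.

Lemma mulmx_sub x y i : (M *m (x - y)) i 0 = (M *m x) i 0 - (M *m y) i 0.
Proof. by rewrite mulmxBr !mxE. Qed.

Lemma mul_row_mx i x : (row i M *m x) 0 0 = (M *m x) i 0.
Proof. by rewrite -row_mul mxE. Qed.

End MulmxEntry.

Section Polyhedron.
Local Open Scope ring_scope.
Variables (R : realType) (q d : nat) (M : 'M[R]_(q, d)) (b : 'cV[R]_q).
Implicit Types (x y z u v w p : 'cV[R]_d) (I J : {set 'I_q}).

Definition inP x := forall i, (M *m x) i 0 <= b i 0.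

Definition active x : {set 'I_q} := finset (fun i => (M *m x) i 0 == b i 0).

(** The smallest face through x, see [face_ge_minface]; x represents its relative interior. *)
Definition minface x : set 'cV[R]_d :=
  fun y => inP y /\ active x \subset active y.

Definition killed I u := forall i, i \in I -> (M *m u) i 0 = 0.

Lemma activeP x i : reflect ((M *m x) i 0 = b i 0) (i \in active x).
Proof. by rewrite inE; exact: eqP. Qed.

Lemma active_lt x i : inP x -> (i \notin active x) = ((M *m x) i 0 < b i 0).
Proof. by move=> Px; rewrite inE lt_neqAle Px andbT. Qed.

Lemma minface_refl x : inP x -> minface x x.
Proof. by split. Qed.

Lemma minface_subset x y :
  inP x -> (minface x `<=` minface y)%classic <-> active y \subset active x.
Proof.
move=> Px; split=> [/(_ x (minface_refl Px)) [] // | syx z [Pz sxz]].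
by split=> //; exact: subset_trans sxz.
Qed.

Lemma killed_sub x y : minface x y -> killed (active x) (y - x).
Proof.
move=> [Py /subsetP sxy] i ix; rewrite mulmx_sub (activeP y i (sxy _ ix)).
by rewrite (activeP x i ix) subrr.
Qed.

(** Tight rows do not increase along v, and slack rows leave room for a short step; a tight row
    stays tight iff it annihilates v. *)
Lemma small_step x v : inP x ->
  (forall i, i \in active x -> (M *m v) i 0 <= 0) ->
  exists e : R, [/\ 0 < e, inP (x + e *: v) &
    forall i, i \in active (x + e *: v) =
              (i \in active x) && ((M *m v) i 0 == 0)].
Proof.
move=> Px vle.
pose s i := b i 0 - (M *m x) i 0.
have s_ge i : 0 <= s i by rewrite subr_ge0.
(* Exceeds the ratio of every slack row; at tight rows the quotient by 0 is 0. *)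
pose B := 1 + \sum_i `|(M *m v) i 0| / s i.
have B_gt0 : 0 < B.
  by apply: ltr_pwDl => //; apply: sumr_ge0 => i _; rewrite divr_ge0.
have bnd i : i \notin active x -> B^-1 * (M *m v) i 0 < s i.
  move=> ix; have si : 0 < s i by rewrite subr_gt0 -active_lt.
  rewrite mulrC ltr_pdivrMr // mulrC -ltr_pdivrMr //.
  apply: (@le_lt_trans _ _ (`|(M *m v) i 0| / s i)).
    by rewrite ler_pM2r ?invr_gt0 // ler_norm.
  rewrite /B (bigD1 i) //= addrCA ltrDl.
  by apply: ltr_pwDl => //; apply: sumr_ge0 => j _; rewrite divr_ge0.
exists B^-1; split; first by rewrite invr_gt0.
- move=> i; rewrite mulmx_line; case: (boolP (i \in active x)) => ix.
    rewrite (activeP x i ix) gerDl pmulr_rle0 ?invr_gt0 //; exact: vle.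
  by have := bnd i ix; rewrite /s; lra.
- move=> i; rewrite inE mulmx_line; case: (boolP (i \in active x)) => ix /=.
    rewrite (activeP x i ix) -subr_eq0 addrC addKr mulf_eq0 invr_eq0.
    by rewrite gt_eqF.
  by apply/eqP => h; have := bnd i ix; rewrite /s; lra.
Qed.

(** Boundedness forces some row to increase along u; the ratio test picks the first such row to
    become tight. *)
Lemma ray_exit x u : bounded inP -> inP x -> u != 0 ->
  exists (t : R) (i : 'I_q), [/\ 0 <= t, inP (x + t *: u),
    i \in active (x + t *: u) & 0 < (M *m u) i 0].
Proof.
move=> [B bP] Px u_neq0.
have [i0 i0gt] : exists i, 0 < (M *m u) i 0.
  apply: contrapT => no.
  have neg i : (M *m u) i 0 <= 0.
    by rewrite leNgt; apply/negP => h; apply: no; exists i.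
  have [j uj] : exists j, u j 0 != 0.
    apply: contrapT => no'; move/eqP: u_neq0; apply; apply/matrixP => j k.
    rewrite (ord1 k) mxE; apply/eqP/negPn/negP => h; apply: no'; by exists j.
  have uj0 : 0 < `|u j 0| by rewrite normr_gt0.
  have B0 : 0 <= B by apply: le_trans (bP x Px j); rewrite normr_ge0.
  (* Makes the j-th coordinate of the displacement so long that x + t u violates the bound B. *)
  pose t := (B + `|x j 0| + 1) / `|u j 0|.
  have t_ge0 : 0 <= t by rewrite divr_ge0 // !addr_ge0.
  have Pt : inP (x + t *: u).
    move=> i; rewrite mulmx_line; have := neg i; have := Px i.
    by have := @mulr_ge0_le0 _ t _ t_ge0 (neg i); lra.
  have := bP _ Pt j; rewrite !mxE.
  have e : `|t * u j 0| = B + `|x j 0| + 1.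
    by rewrite normrM (ger0_norm t_ge0) divfK // gt_eqF.
  have := ler_normB (x j 0 + t * u j 0) (x j 0).
  rewrite (_ : x j 0 + t * u j 0 - x j 0 = t * u j 0); last by ring.
  by rewrite e => h1 h2; lra.
pose r i := (b i 0 - (M *m x) i 0) / (M *m u) i 0.
case: (@Order.TotalTheory.arg_minP _ _ _ i0
  (fun i => 0 < (M *m u) i 0) r i0gt) => i igt imin.
have r_ge0 : 0 <= r i by apply: divr_ge0; [rewrite subr_ge0; exact: Px | exact: ltW].
exists (r i), i; split => //.
- move=> j; rewrite mulmx_line.
  case: (ltP 0 ((M *m u) j 0)) => [jgt | jle].
    have := imin j jgt; rewrite {2}/r ler_pdivlMr //; lra.
  have := Px j; have := mulr_ge0_le0 r_ge0 jle; lra.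
- by apply/activeP; rewrite mulmx_line divfK ?gt_eqF //; ring.
Qed.

(** [kermx] is a left kernel, hence the transpose; rows outside I are replaced by 0, so that the
    format does not depend on I. *)
Definition kmx I : 'M[R]_d :=
  kermx (\matrix_(j < d, i < q) (if i \in I then M i j else 0)).

Definition kdim I : nat := \rank (kmx I).

Lemma kmxP I u : reflect (killed I u) (u^T <= kmx I)%MS.
Proof.
have E i : (u^T *m \matrix_(j < d, i < q) (if i \in I then M i j else 0)) 0 i =
    if i \in I then (M *m u) i 0 else 0.
  rewrite !mxE; case: ifP => iI; last first.
    by rewrite big1 // => j _; rewrite !mxE iI mulr0.
  by apply: eq_bigr => j _; rewrite !mxE iI mulrC.
apply: (iffP sub_kermxP) => [h i iI | h].
  by have := E i; rewrite h iI mxE.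
by apply/rowP => i; rewrite E [RHS]mxE; case: ifP => // iI; exact: h.
Qed.

Lemma kmx_subset I J : (kmx I <= kmx J)%MS <-> (forall u, killed I u -> killed J u).
Proof.
split=> [s u /kmxP uI | h]; first by apply/kmxP; exact: submx_trans s.
apply/rV_subP => u; rewrite -[u]trmxK => /kmxP uI; exact/kmxP/h.
Qed.

Lemma killed_subset I J u : I \subset J -> killed J u -> killed I u.
Proof. by move=> /subsetP s h i iI; exact/h/s. Qed.

Lemma sum_const_mx r (lambda : 'cV[R]_r) :
  (const_mx 1 : 'rV_r) *m lambda = (\sum_j lambda j 0)%:M.
Proof.
apply/matrixP => i j; rewrite !mxE !ord1 eqxx mulr1n.
by apply: eq_bigr => k _; rewrite !mxE mul1r.
Qed.

(** The points are x and short steps from x along a basis of the kernel of its tight rows; positive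
    step lengths preserve linear independence. *)
Lemma affine_indep_minface x : inP x ->
  has_affine_indep (minface x) (1 + kdim (active x)).
Proof.
move=> Px; set I := active x; set B := row_base (kmx I).
have kB j : killed I (row j B)^T.
  apply/kmxP; rewrite trmxK; apply: submx_trans (row_sub _ _) _.
  by rewrite eq_row_base.
have /choice [e eP] j : exists e, 0 < e /\ minface x (x + e *: (row j B)^T).
  have [i ix | e [e0 Pe ae]] := @small_step x (row j B)^T Px.
    by rewrite (kB j).
  exists e; split=> //; split=> //; apply/subsetP => i ix.
  by rewrite ae ix (kB j) ?eqxx.
pose U := B^T *m diag_mx (\row_j e j).
exists (x *m (const_mx 1 : 'rV_(1 + _)) + row_mx 0 U : 'M_(d, 1 + _)); split.
  move=> j; case: (split_ordP (j : 'I_(1 + kdim I))) => k ->.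
    suff -> : col (lshift _ k) (x *m (const_mx 1 : 'rV_(1 + _)) + row_mx 0 U) = x.
      exact: minface_refl.
    by apply/colP => i; rewrite 2!mxE row_mxEl !mxE big_ord1 !mxE mulr1 addr0.
  suff -> : col (rshift 1 k) (x *m (const_mx 1 : 'rV_(1 + _)) + row_mx 0 U)
    = x + e k *: (row k B)^T by case: (eP k).
  apply/colP => i; rewrite 2!mxE row_mxEr /U mul_mx_diag !mxE big_ord1 !mxE mulr1.
  by rewrite mulrC.
move=> lambda s0; rewrite mulmxDl -mulmxA sum_const_mx s0.
rewrite raddf0 mulmx0 add0r.
rewrite -[lambda]vsubmxK mul_row_col mul0mx add0r => Ul.
have d0 : dsubmx lambda = 0.
  have {}Ul : diag_mx (\row_j e j) *m dsubmx lambda = 0.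
    apply/trmx_inj/(row_free_inj (row_base_free (kmx I))).
    by rewrite trmx0 mul0mx -[row_base _]trmxK -trmx_mul mulmxA Ul trmx0.
  apply/colP => k; move/colP: Ul => /(_ k); rewrite mul_diag_mx !mxE => /eqP.
  rewrite mulf_eq0 gt_eqF /=; last by case: (eP k).
  by move/eqP.
move: s0; rewrite -[lambda]vsubmxK d0 big_split_ord big_ord1 /=.
rewrite [X in _ + X]big1 ?addr0 => [|k _]; last by rewrite col_mxEd mxE.
rewrite col_mxEu => u0; apply/colP => j.
by case: (split_ordP j) => k ->;
  rewrite ?(col_mxEu, col_mxEd) ?(ord1 k) [RHS]mxE ?(col_mxKu, col_mxKd) ?u0 ?mxE.
Qed.

(** The differences to the first point lie in the kernel of the tight rows and are linearly
    independent. *)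
Lemma affine_indep_bound x r :
  has_affine_indep (minface x) r -> (r <= (kdim (active x)).+1)%N.
Proof.
case: r => // r; rewrite -[r.+1]add1n => -[Y [Yx Yi]]; rewrite add1n ltnS.
pose D := (rsubmx Y - lsubmx Y *m const_mx 1)^T.
have Df : row_free D.
  rewrite -kermx_eq0; apply/eqP/row_matrixP => i; rewrite row0.
  have := mulmx_ker D; move/(congr1 (row i)); rewrite row_mul row0.
  move: (row i _) => mu muD.
  (* The first coefficient makes the sum vanish and turns a linear relation among differences into
     an affine one. *)
  pose lambda : 'cV_(1 + r) := col_mx (- (const_mx 1 *m mu^T)) mu^T.
  have /(congr1 (@dsubmx _ 1 r 1)) : lambda = 0.
    apply: Yi.
      rewrite big_split_ord big_ord1 col_mxEu sum_const_mx !mxE eqxx mulr1n.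
      rewrite /= -[RHS](addNr (\sum_j mu^T j 0)); congr (_ + _).
      by apply: eq_bigr => j _; rewrite col_mxEd.
    rewrite -[Y]hsubmxK mul_row_col mulmxN mulmxA addrC -mulmxBl.
    by apply: trmx_inj; rewrite trmx_mul trmxK -/D muD trmx0.
  by rewrite col_mxKd => /(congr1 trmx); rewrite trmxK => ->; rewrite raddf0 trmx0.
rewrite -(eqP Df); apply: mxrankS; apply/row_subP => k.
rewrite -[row k D]trmxK; apply/kmxP => i ix.
have -> : (row k D)^T = col (rshift 1 k) Y - col (lshift r 0) Y.
  by apply/colP => j; rewrite !mxE big_ord1 !mxE mulr1.
rewrite mulmx_sub.
have [_ /subsetP s1] := Yx (rshift 1 k); have [_ /subsetP s2] := Yx (lshift r 0).
by rewrite (activeP _ _ (s1 _ ix)) (activeP _ _ (s2 _ ix)) subrr.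
Qed.

Lemma affdim_minface x : inP x -> affdim (minface x) = (kdim (active x))%:Z.
Proof.
move=> Px; rewrite /affdim.
suff -> : (\max_(r < d.+2 | `[< has_affine_indep (minface x) r >]) r)%N
    = (kdim (active x)).+1 by rewrite -addn1 PoszD addrK.
apply/eqP; rewrite eqn_leq; apply/andP; split.
  by apply/bigmax_leqP => r /asboolP; exact: affine_indep_bound.
have lt : ((kdim (active x)).+1 < d.+2)%N by rewrite !ltnS rank_leq_col.
apply: (@leq_bigmax_cond _ _ (fun r : 'I_(d.+2) => nat_of_ord r) (Ordinal lt)).
exact/asboolP/affine_indep_minface.
Qed.

Lemma kdim_le I J : I \subset J -> (kdim J <= kdim I)%N.
Proof. by move=> s; apply/mxrankS/kmx_subset => u; exact: killed_subset. Qed.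

(** With equal dimensions both kernels would agree; then x - y, annihilated by the rows tight at y,
    would be annihilated by those tight at x, which would be tight at y as well. *)
Lemma kdim_lt x y : minface y x -> ~~ (active x \subset active y) ->
  (kdim (active x) < kdim (active y))%N.
Proof.
move=> yx; have [Px s] := yx; rewrite ltn_neqAle kdim_le // andbT.
apply: contraNneq => e.
have K : (kmx (active x) <= kmx (active y))%MS.
  by apply/kmx_subset => u; exact: killed_subset.
have := mxrank_leqif_sup K; rewrite /kdim in e; rewrite /leqif e eqxx => -[_ /esym].
move=> /kmx_subset/(_ _ (killed_sub yx)) k.
apply/subsetP => i ix; apply/activeP.
by have := k i ix; rewrite mulmx_sub (activeP x i ix); lra.
Qed.

(* Rotating from w away from u as long as the rows of J allow it, some row on
   which u is negative becomes tight. *)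
Lemma rotate_until_tight J w u :
  (forall i, i \in J -> (M *m w) i 0 <= 0) ->
  (forall i, i \in J -> (M *m u) i 0 < 0 -> (M *m w) i 0 < 0) ->
  (exists2 i, i \in J & (M *m u) i 0 < 0) ->
  exists (t : R) (i : 'I_q), [/\ i \in J, (M *m u) i 0 < 0,
    (M *m (w + t *: u)) i 0 = 0 &
    forall j, j \in J -> (M *m (w + t *: u)) j 0 <= 0].
Proof.
move=> wle wlt [i0 i0J i0u].
pose r i := (M *m w) i 0 / (M *m u) i 0.
have H0 : (i0 \in J) && ((M *m u) i0 0 < 0) by rewrite i0J.
case: (@Order.TotalTheory.arg_minP _ _ _ i0
  (fun i => (i \in J) && ((M *m u) i 0 < 0)) r H0) => i /andP[iJ iu] imin.
have r_ge0 : 0 <= r i by apply: mulr_le0; [exact: wle | rewrite invr_le0 ltW].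
exists (- r i), i; split=> //.
  by rewrite mulmx_line mulNr divfK ?lt_eqF // subrr.
move=> j jJ; rewrite mulmx_line; case: (ltP ((M *m u) j 0) 0) => [ju | ju].
  have := imin j; rewrite jJ ju => /(_ isT).
  by rewrite {2}/r ler_ndivlMr // mulNr; lra.
by have := wle j jJ; have := mulr_ge0 r_ge0 ju; rewrite mulNr; lra.
Qed.

(** If the minimal p had larger codimension, the direction [w = y - p], tilted by some u in the
    kernel at y, would release a row tight at p and still keep one at which z is slack. *)
Lemma facet_separation x y z :
  inP x -> inP y -> minface y x -> minface y z -> ~ minface x z ->
  exists p, [/\ inP p, minface y p, minface p x, ~ minface p z &
    kdim (active y) = (kdim (active p)).+1].
Proof.
move=> Px Py yx yz nxz.
pose sep p := [/\ inP p, minface y p, minface p x & ~ minface p z].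
have exn : exists n, `[< exists p, sep p /\ #|active p| = n >].
  by exists #|active x|; apply/asboolP; exists x.
case: (ex_minnP exn) => n /asboolP[p [[Pp yp px npz] pn]] pmin.
exists p; split=> //.
have [i0 i0p i0z] : exists2 i, i \in active p & (M *m z) i 0 < b i 0.
  have [Pz _] := yz; have : ~~ (active p \subset active z).
    by apply/negP => s; apply: npz.
  by case/subsetPn => i ip; rewrite active_lt // => iz; exists i.
have yi0 : i0 \notin active y.
  apply/negP => h; have [_ /subsetP/(_ _ h)] := yz.
  by apply/negP; rewrite active_lt //; case: yz.
have pny : ~~ (active p \subset active y) by apply/subsetPn; exists i0.
have lt := kdim_lt yp pny.
apply/eqP; rewrite eqn_leq lt andbT leqNgt; apply/negP => lt2.
pose w := y - p.
have wy : killed (active y) w.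
  by move=> i iy; rewrite /w -opprB mulmxN mxE (killed_sub yp) ?oppr0.
have w_le i : i \in active p -> (M *m w) i 0 <= 0.
  by move=> ip; rewrite mulmx_sub (activeP p i ip) subr_le0.
have w_lt i : i \in active p -> i \notin active y -> (M *m w) i 0 < 0.
  by move=> ip; rewrite active_lt // mulmx_sub (activeP p i ip) subr_lt0.
(* The second condition guarantees that some row is released; the last one that the row kept tight
   by the rotation is slack at z. *)
have [u [uy uind [j jp ju] uz]] : exists u, [/\ killed (active y) u,
    forall t, ~ killed (active p) (w + t *: u),
    exists2 i, i \in active p & (M *m u) i 0 < 0 &
    forall i, i \in active p -> (M *m u) i 0 < 0 -> (M *m z) i 0 < b i 0].
  (* The direction to z serves as u unless, on the rows tight at p, it is proportional to w. *)
  case: (pselect (exists t, killed (active p) (w + t *: (z - p)))); last first.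
    move=> no; exists (z - p); split.
    - move=> i iy; rewrite -[z](subrK y) -addrA -[y - p]opprB mulmx_sub.
      by rewrite (killed_sub yz) // (killed_sub yp) // subrr.
    - by move=> t h; apply: no; exists t.
    - by exists i0 => //; rewrite mulmx_sub (activeP p i0 i0p) subr_lt0.
    - by move=> i ip; rewrite mulmx_sub (activeP p i ip) subr_lt0.
  case=> t kt.
  (* Here t is negative, so on these rows z - p is a positive multiple of w: z is slack wherever y
     is. *)
  have zlt i : i \in active p -> i \notin active y -> (M *m z) i 0 < b i 0.
    move=> ip iy; have := kt i ip; have := kt i0 i0p.
    rewrite !mulmx_line !mulmx_sub (activeP p i ip) (activeP p i0 i0p).
    have := w_lt i ip iy; have := w_lt i0 i0p yi0.
    rewrite !mulmx_sub (activeP p i ip) (activeP p i0 i0p).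
    set Z0 := (M *m z) i0 0 in i0z *; set Z := (M *m z) i 0.
    move: ((M *m y) i0 0) ((M *m y) i 0) => Y0 Y h1 h2 h3 h4.
    have t0 : t < 0.
      rewrite ltNge; apply/negP => t0; have : t * (Z0 - b i0 0) <= 0.
        by rewrite mulr_ge0_le0 // subr_le0 ltW.
      lra.
    rewrite ltNge; apply/negP => h; have : t * (Z - b i 0) <= 0.
      by rewrite mulr_le0_ge0 ?subr_ge0 // ltW.
    lra.
  (* The kernel at y exceeds that at p by at least two dimensions, so adding the one vector w to the
     latter leaves some u outside. *)
  have [u uy uind] : exists2 u, killed (active y) u &
      ~~ (u^T <= kmx (active p) + w^T)%MS.
    have : ~~ (kmx (active y) <= kmx (active p) + w^T)%MS.
      apply/negP => /mxrankS; rewrite leqNgt => /negP; apply.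
      apply: leq_ltn_trans (mxrank_adds_leqif _ _) _.
      apply: leq_ltn_trans lt2; rewrite -(addn1 (kdim _)) leq_add2l.
      exact: rank_leq_row.
    case/row_subPn => k uk; exists (row k (kmx (active y)))^T; last by rewrite trmxK.
    by apply/kmxP; rewrite trmxK row_sub.
  have nw : ~ killed (active p) w.
    by move=> /(_ i0 i0p); have := w_lt i0 i0p yi0; lra.
  have indep t' : ~ killed (active p) (w + t' *: u).
    case: (eqVneq t' 0) => [-> | t0]; first by rewrite scale0r addr0.
    move=> /kmxP h; move/negP: uind; apply.
    have -> : u^T = t'^-1 *: ((w + t' *: u)^T - w^T).
      by apply/rowP => k; rewrite !mxE; field.
    by rewrite scalemx_sub // addmx_sub_adds // eqmx_opp.
  have [i ip iu] : exists2 i, i \in active p & (M *m u) i 0 != 0.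
    have : ~ killed (active p) u.
      move=> /kmxP h; move/negP: uind; apply.
      exact: submx_trans h (addsmxSl _ _).
    move=> nk; apply: contrapT => no; apply: nk => i ip.
    by apply/eqP/negPn/negP => h; apply: no; exists i.
  have hz v : killed (active y) v -> forall i, i \in active p ->
      (M *m v) i 0 < 0 -> (M *m z) i 0 < b i 0.
    move=> vy k kp kv; apply: zlt => //; apply/negP => ky.
    by move: kv; rewrite vy // ltxx.
  have kN v : killed (active y) v -> killed (active y) (- v).
    by move=> h k ky; rewrite mulmxN mxE h // oppr0.
  case: (ltrgt0P ((M *m u) i 0)) iu => // iu _.
    exists (- u); split; [exact: kN | | | exact/hz/kN].
      by move=> t' h; apply: (indep (- t')); rewrite scaleNr -scalerN.
    by exists i => //; rewrite mulmxN mxE oppr_lt0.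
  by exists u; split => //; [exists i | exact: hz].
have u_lt i : i \in active p -> (M *m u) i 0 < 0 -> (M *m w) i 0 < 0.
  move=> ip iu; apply: w_lt => //; apply/negP => iy; by move: iu; rewrite uy ?ltxx.
have [|t [i [ip iu it vle]]] := rotate_until_tight w_le u_lt.
  by exists j.
(* The point reached has fewer tight rows than p; its face still contains x and, by row i, still
   misses z. *)
have [e [e0 Pe ae]] := small_step Pp vle.
set p' := p + _ in Pe ae.
have sub : active p' \subset active p.
  by apply/subsetP => k; rewrite ae => /andP[].
have : (#|active p'| < #|active p|)%N.
  apply: proper_card; rewrite properE sub /=; apply/negP => /subsetP s.
  by apply: (uind t) => k kp; have := s k kp; rewrite ae kp => /eqP.
apply/negP; rewrite -leqNgt pn; apply: pmin; apply/asboolP; exists p'; split=> //.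
split=> //.
- split=> //; apply/subsetP => k ky; rewrite ae.
  have [_ /subsetP ->] := yp => //=.
  by rewrite mulmx_line wy // uy // mulr0 addr0.
- by case: px => _ s; split=> //; exact: subset_trans s.
- case=> _ /subsetP/(_ i); rewrite ae ip it eqxx => /(_ isT) /activeP.
  by have := uz i ip iu; lra.
Qed.

Lemma kdim0P I : reflect (forall u, killed I u -> u = 0) (kdim I == 0)%N.
Proof.
rewrite mxrank_eq0; apply: (iffP eqP) => [k0 u /kmxP | h].
  by rewrite k0 submx0 => /eqP/(congr1 trmx); rewrite trmxK trmx0.
apply/eqP; rewrite -submx0; apply/rV_subP => u; rewrite -[u]trmxK => /kmxP/h ->.
by rewrite trmx0 sub0mx.
Qed.

(** Move inside the face of x, along u or -u so that c does not increase, until a further row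
    becomes tight; the dimension drops. With c = 0 this just finds a vertex; with c a row of M, the
    vertex is slack at that row whenever x is. *)
Lemma vertex_below (c : 'rV[R]_d) x : bounded inP -> inP x ->
  exists p, [/\ minface x p, (c *m p) 0 0 <= (c *m x) 0 0 &
                kdim (active p) = 0%N].
Proof.
move=> bP; have [n] := ubnP (kdim (active x)); elim: n x => // n IH x lt Px.
have [e | /(elimN (kdim0P _)) nk] := eqVneq (kdim (active x)) 0%N.
  by exists x; split => //; exact: minface_refl.
have [u [ku u0 cu]] : exists u, [/\ killed (active x) u, u != 0 &
    (c *m u) 0 0 <= 0].
  have [u [ku u0]] : exists u, killed (active x) u /\ u != 0.
    apply: contrapT => no; apply: nk => u ku.
    by apply/eqP/negPn/negP => u0; apply: no; exists u.
  case: (lerP ((c *m u) 0 0) 0) => [le | gt]; first by exists u.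
  exists (- u); rewrite oppr_eq0 mulmxN mxE oppr_le0 ltW //; split=> // i ix.
  by rewrite mulmxN mxE ku // oppr0.
have [t [i [t0 Px' ix' iu]]] := ray_exit bP Px u0.
set x' := x + t *: u in Px' ix'.
have xx' : minface x x'.
  split=> //; apply/subsetP => j jx; apply/activeP.
  by rewrite mulmx_line ku // mulr0 addr0; apply/activeP.
have ninc : ~~ (active x' \subset active x).
  by apply/subsetPn; exists i => //; apply/negP => /ku h; rewrite h ltxx in iu.
have [p [pp cp p0]] := IH x' (leq_trans (kdim_lt xx' ninc) lt) Px'.
exists p; split=> //.
  case: pp => Pp s; split=> //; exact: subset_trans (proj2 xx') s.
apply: le_trans cp _; rewrite mulmx_line gerDl.
exact: mulr_ge0_le0.
Qed.

(** Exposed by the sum of the rows tight at x: a sum of nonnegative slacks vanishes only if each of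
    them does. *)
Lemma face_minface x : inP x -> face inP (minface x).
Proof.
move=> Px; pose c := \sum_(i in active x) row i M.
have cE y : (c *m y) 0 0 = \sum_(i in active x) (M *m y) i 0.
  rewrite mulmx_suml summxE; apply: eq_bigr => i _; exact: mul_row_mx.
exists c, (\sum_(i in active x) b i 0); split.
  by move=> y Py; rewrite cE; apply: ler_sum => i _; exact: Py.
rewrite predeqE => y; split=> [[Py /subsetP s] | [Py /=]].
  split=> //=; rewrite cE; apply: eq_bigr => i /s; exact/activeP.
rewrite cE => /eqP; rewrite eq_sym -subr_eq0 -sumrB psumr_eq0 => [/allP h|i _].
  split=> //; apply/subsetP => i ix; apply/activeP.
  have := h i (mem_index_enum i); rewrite ix /= subr_eq0 => /eqP; exact: esym.
by rewrite subr_ge0.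
Qed.

(** Take x in F with the fewest tight rows. A step towards another point y of F cannot release any
    of them, so y is tight there too. Conversely, if y lies in [minface x], a step from x away from
    y stays feasible, which forces the functional at y up to its maximum. *)
Lemma face_cases F : face inP F ->
  F = classical_sets.set0 \/ exists2 x, inP x & F = minface x.
Proof.
move=> [c [delta [cle ->]]]; set F' := (_ `&` _)%classic.
case: (pselect (exists x, F' x)) => [[x0 Fx0] | no]; [right | left]; last first.
  by rewrite predeqE => x; split=> // Fx; case: no; exists x.
have exn : exists n, `[< exists x, F' x /\ #|active x| = n >].
  by exists #|active x0|; apply/asboolP; exists x0.
case: (ex_minnP exn) => n /asboolP[x [[Px /= cx] xn]] xmin.
exists x => //; rewrite predeqE => y; split.
  move=> [Py cy]; split=> //.
  have [e [e0 Pm am]] : exists e, [/\ 0 < e, inP (x + e *: (y - x)) &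
      forall i, i \in active (x + e *: (y - x)) =
              (i \in active x) && ((M *m (y - x)) i 0 == 0)].
    apply: small_step => // i ix.
    by rewrite mulmx_sub (activeP x i ix) subr_le0.
  set m := x + _ in Pm am.
  have Fm : F' m.
    split=> //=; rewrite mulmx_line mulmx_sub cx.
    by move: cy => /= ->; ring.
  have sub : active m \subset active x.
    by apply/subsetP => i; rewrite am => /andP[].
  have /eqP e_am : active m == active x.
    rewrite eqEcard sub /= xn; apply: xmin; apply/asboolP; by exists m.
  apply/subsetP => i ix; have := ix; rewrite -e_am am ix mulmx_sub subr_eq0.
  by rewrite (activeP x i ix) => /eqP/activeP.
move=> [Py /subsetP sy]; split=> //=; apply/le_anti; rewrite cle //=.
have [e [e0 Pm _]] : exists e, [/\ 0 < e, inP (x + e *: (x - y)) &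
      forall i, i \in active (x + e *: (x - y)) =
              (i \in active x) && ((M *m (x - y)) i 0 == 0)].
  apply: small_step => // i ix; rewrite mulmx_sub (activeP x i ix).
  by rewrite (activeP y i (sy _ ix)) subrr.
have := cle _ Pm.
by rewrite mulmx_line mulmx_sub cx gerDl pmulr_rle0 // subr_le0.
Qed.

End Polyhedron.

(** * Faces of a polytope as closed vertex sets *)

Section Incidence.
Local Open Scope ring_scope.
Variables (R : realType) (q d : nat) (M : 'M[R]_(q, d)) (b : 'cV[R]_q).
Local Notation P := (inP M b).
Local Notation active := (active M b).
Local Notation minface := (minface M b).
Local Notation kdim := (kdim M).
Hypothesis bP : bounded P.
Implicit Types (x y z p : 'cV[R]_d) (F G : set 'cV[R]_d).

Lemma affdim_set0 : affdim (classical_sets.set0 : set 'cV[R]_d) = -1.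
Proof.
rewrite /affdim big1 // => r /asboolP [X [X0 _]].
by case: r X X0 => [[|r] lt] X X0 //; case: (X0 ord0).
Qed.

Lemma face_set0 : face P classical_sets.set0.
Proof.
exists 0, 1; split=> [x _|]; first by rewrite mul0mx mxE ler01.
rewrite predeqE => x; split=> // -[_ /=]; rewrite mul0mx mxE => /eqP.
by rewrite eq_sym oner_eq0.
Qed.

Lemma face_setT : face P P.
Proof.
exists 0, 0; split=> [x _|]; first by rewrite mul0mx mxE.
by rewrite predeqE => x; split=> [Px | []//]; split=> //=; rewrite mul0mx mxE.
Qed.

Lemma face_setI F G : face P F -> face P G -> face P (F `&` G)%classic.
Proof.
move=> [c [e [cF ->]]] [c' [e' [cG ->]]]; exists (c + c'), (e + e'); split.
  by move=> x Px; rewrite mulmxDl [leLHS]mxE lerD ?cF ?cG.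
have E x : ((c + c') *m x) 0 0 = (c *m x) 0 0 + (c' *m x) 0 0.
  by rewrite mulmxDl [LHS]mxE.
rewrite predeqE => x /=; rewrite E; split; first by move=> [[Px ->] [_ ->]].
move=> [Px h]; have := cF x Px; have := cG x Px => h1 h2.
by split; split=> //=; lra.
Qed.

Lemma face_ge_minface F p : face P F -> P p ->
  (minface p `<=` F)%classic <-> F p.
Proof.
move=> /face_cases[->|[x Px ->]] Pp.
  by split=> // /(_ p (minface_refl Pp)).
by rewrite minface_subset //; split=> [s | []].
Qed.

Lemma face_sub F : face P F -> (F `<=` P)%classic.
Proof. by move=> [c [e [_ ->]]] x []. Qed.

Lemma affdim_face_ge F : face P F -> exists k : nat, affdim F + 1 = k%:Z.
Proof.
move=> /face_cases[->|[x Px ->]]; first by exists 0%N; rewrite affdim_set0.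
by exists (kdim (active x)).+1; rewrite affdim_minface // -PoszD addn1.
Qed.

Lemma affdim_face_lt F G : face P F -> face P G -> (F `<` G)%classic ->
  affdim F < affdim G.
Proof.
move=> /face_cases[->|[x Px ->]] /face_cases[->|[y Py ->]].
- by case=> _ [].
- by rewrite affdim_set0 affdim_minface.
- by move=> [/(_ x (minface_refl Px))].
rewrite !affdim_minface // ltz_nat => -[s ns].
apply: kdim_lt; first exact/s/minface_refl.
by apply/negP => sxy; apply/ns/minface_subset.
Qed.

(** [facet_separation] starts from a nonempty face missing z. F is one unless it is empty, and then
    the first alternative supplies one; that alternative fails when G is the single point z, a case
    the callers treat separately. *)
Lemma exists_facet_face F G z : face P F -> face P G -> (F `<=` G)%classic ->
  G z -> ~ F z -> (exists2 p, G p & ~ minface p z) \/ F <> classical_sets.set0 ->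
  exists H, [/\ face P H, (F `<=` H)%classic, (H `<=` G)%classic, ~ H z &
                affdim H = affdim G - 1].
Proof.
move=> /face_cases + /face_cases[->//|[y Py ->]].
have key x : P x -> minface y x -> minface y z -> ~ minface x z ->
    exists H, [/\ face P H, (minface x `<=` H)%classic,
      (H `<=` minface y)%classic, ~ H z & affdim H = affdim (minface y) - 1].
  move=> Px yx yz nxz.
  have [p [Pp yp px npz e]] := facet_separation Px Py yx yz nxz.
  exists (minface p); split=> //; first exact: face_minface.
  - by apply/minface_subset => //; case: px.
  - by apply/minface_subset => //; case: yp.
  - by rewrite !affdim_minface // e -addn1 PoszD addrK.
move=> [->|[x Px ->]] s Gz nFz; last first.
  by move=> _; apply: key => //; apply/s/minface_refl.
case=> // -[x yx nxz]; have [|H [? _ ? ? ?]] := key x _ yx Gz nxz.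
  by case: yx.
by exists H; split.
Qed.

Variables (m n : nat) (A : 'M[bool]_(m, n)).
Variables (fct : 'I_m -> set 'cV[R]_d) (vtx : 'I_n -> set 'cV[R]_d).
Hypothesis fct_inj : injective fct.
Hypothesis fctP : forall F, facet P F <-> exists i, F = fct i.
Hypothesis vtx_inj : injective vtx.
Hypothesis vtxP : forall F, vertex P F <-> exists j, F = vtx j.
Hypothesis incP : forall i j, A i j <-> (vtx j `<=` fct i)%classic.
Implicit Types S T U : {set 'I_n}.

Definition vertices F : {set 'I_n} :=
  finset (fun j => `[< (vtx j `<=` F)%classic >]).

(** The smallest face containing the vertices in S; it is P itself if no facet contains S. *)
Definition face_of S : set 'cV[R]_d :=
  fun x => P x /\ forall i, (forall j, j \in S -> A i j) -> fct i x.

(** Faces have [affdim] at least -1, so the absolute value loses nothing, see [face_rankE]. *)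
Definition face_rank S : nat := absz (affdim (face_of S) + 1).

Lemma mem_vertices F j : (j \in vertices F) <-> (vtx j `<=` F)%classic.
Proof. by rewrite inE; split=> /asboolP. Qed.

Lemma vertices_subset F G : (F `<=` G)%classic -> vertices F \subset vertices G.
Proof. by move=> s; apply/subsetP => j /mem_vertices vF; apply/mem_vertices => x /vF /s. Qed.

Lemma face_fct i : face P (fct i).
Proof. by have /fctP[] : exists i', fct i = fct i' by exists i. Qed.

Lemma vtx_minface j : exists p, [/\ P p, kdim (active p) = 0%N & vtx j = minface p].
Proof.
have /vtxP[fj dj] : exists j', vtx j = vtx j' by exists j.
case: (face_cases fj) => [e|[p Pp e]]; first by rewrite e affdim_set0 in dj.
by exists p; split=> //; move: dj; rewrite e affdim_minface // => -[].
Qed.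

Lemma minface_vtx p : P p -> kdim (active p) = 0%N -> exists j, vtx j = minface p.
Proof.
move=> Pp k0; have [|j ->] := (vtxP (minface p)).1; last by exists j.
by split; [exact: face_minface | rewrite affdim_minface // k0].
Qed.

Lemma exists_vertex F : face P F -> F <> classical_sets.set0 ->
  exists j, j \in vertices F.
Proof.
move=> fF; case: (face_cases fF) => [-> // | [x Px Fx] _].
have [p [xp _ p0]] := vertex_below 0 bP Px; have [Pp _] := xp.
have [j vj] := minface_vtx Pp p0; exists j; apply/mem_vertices.
by rewrite vj face_ge_minface // Fx.
Qed.

(** If y in F lies outside G, some row tight on G is slack at y. Descending along this row inside
    the face of y reaches a vertex of F where it is still slack, hence a vertex outside G. *)
Lemma face_subsetP F G : face P F -> face P G ->
  vertices F \subset vertices G -> (F `<=` G)%classic.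
Proof.
move=> fF fG /subsetP s y Fy.
have Py := face_sub fF Fy.
have [j0 /s j0G] : exists j, j \in vertices F.
  by apply: exists_vertex => // F0; rewrite F0 in Fy.
case: (face_cases fG) => [G0|[g Pg Gg]].
  move/mem_vertices: j0G; have [p [Pp _ ->]] := vtx_minface j0.
  by rewrite face_ge_minface // G0.
rewrite Gg; split=> //; apply/subsetP => i ig; apply: contraT => iy.
have [p [yp cp p0]] := vertex_below (row i M) bP Py; have [Pp _] := yp.
have [j vj] := minface_vtx Pp p0.
have /s/mem_vertices : j \in vertices F.
  apply/mem_vertices; rewrite vj face_ge_minface //.
  by apply: (proj2 (face_ge_minface fF Py) Fy).
rewrite vj face_ge_minface // Gg => -[_ /subsetP/(_ i ig) /activeP ip].
by move: iy cp; rewrite active_lt // !mul_row_mx ip; lra.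
Qed.

Lemma face_eqP F G : face P F -> face P G -> vertices F = vertices G -> F = G.
Proof.
move=> fF fG e; rewrite predeqE => x; split.
  by apply: face_subsetP => //; rewrite e.
by apply: face_subsetP => //; rewrite e.
Qed.

Lemma nonempty_generic x : P x -> exists2 y, P y & P = minface y.
Proof.
by move=> Px; case: (face_cases face_setT) => // P0; rewrite P0 in Px.
Qed.

(** If p is not a vertex, any vertex of its face will do. If it is, follow the ray from p through a
    generic point: a row that becomes tight at the exit is slack at p. *)
Lemma exists_other_minface p : P p -> affdim P <> 0 ->
  exists2 x, P x & ~ minface x p.
Proof.
move=> Pp dP; case: (pselect (kdim (active p) = 0%N)) => [k0 | kp]; last first.
  have [v [pv _ v0]] := vertex_below 0 bP Pp; have [Pv _] := pv.
  exists v => // vp; apply: kp; apply/eqP; rewrite -leqn0 -v0.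
  by apply: kdim_le; case: vp.
have [y Py Py'] := nonempty_generic Pp.
have u0 : y - p != 0.
  apply/eqP => /eqP; rewrite subr_eq0 => /eqP e; apply: dP.
  by rewrite Py' affdim_minface // e k0.
have [t [i [t0 Px ix iu]]] := ray_exit bP Pp u0.
exists (p + t *: (y - p)) => // -[_ /subsetP/(_ i ix) /activeP ip].
by move: iu; rewrite mulmx_sub ip; have := Py i; lra.
Qed.

(** A vertex outside F is missed by some facet containing F. If F is empty and P is a point, that
    facet is the empty face. *)
Lemma closed_vertices F : face P F -> facet_closed A (vertices F).
Proof.
move=> fF; rewrite /facet_closed eqEsubset subset_facet_closure andbT.
apply/subsetP => j /facet_closureP h; apply: contraT => /negP jF.
have [p [Pp p0 vj]] := vtx_minface j.
have nFp : ~ F p by move=> Fp; apply/jF/mem_vertices; rewrite vj face_ge_minface.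
suff [H [fH FH _ nHp dH]] : exists H, [/\ face P H, (F `<=` H)%classic,
    (H `<=` P)%classic, ~ H p & affdim H = affdim P - 1].
  have [i Hi] : exists i, H = fct i by apply/fctP.
  exfalso; apply: nHp; apply/(face_ge_minface fH) => //; rewrite -vj Hi.
  apply/incP/h => w /mem_vertices wF; apply/incP; rewrite -Hi => x /wF; exact: FH.
have sub0 : (F `<=` P)%classic by exact: face_sub.
case: (pselect (F = classical_sets.set0)) => [F0 | nF]; last first.
  by apply: exists_facet_face => //; [exact: face_setT | right].
case: (pselect (affdim P = 0)) => [dP | dP].
  exists classical_sets.set0; rewrite dP affdim_set0; split=> //.
    exact: face_set0.
  by rewrite F0.
by apply: exists_facet_face => //; [exact: face_setT | left; exact: exists_other_minface].
Qed.

Lemma face_face_of S : face P (face_of S).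
Proof.
pose F (s : seq 'I_m) x :=
  P x /\ forall i, i \in s -> (forall j, j \in S -> A i j) -> fct i x.
have fF s : face P (F s).
  elim: s => [|i s IH].
    rewrite (_ : F [::] = P); first exact: face_setT.
    by rewrite predeqE => x; split=> [[]|].
  case: (boolP [forall j in S, A i j]) => [/forall_inP iS | /forall_inP iS].
    rewrite (_ : F (i :: s) = (F s `&` fct i)%classic).
      exact: face_setI IH (face_fct i).
    rewrite predeqE => x; split=> [[Px h] | [[Px h] ix]].
      split; last by apply: h => //; exact: mem_head.
      by split=> // k ks; apply: h; rewrite inE ks orbT.
    by split=> // k; rewrite inE => /predU1P[-> // | ]; exact: h.
  rewrite (_ : F (i :: s) = F s) //.
  rewrite predeqE => x; split=> [[Px h] | [Px h]]; split=> // k.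
    by move=> ks; apply: h; rewrite inE ks orbT.
  by rewrite inE => /predU1P[-> // | ]; exact: h.
rewrite (_ : face_of S = F (enum 'I_m)) //.
rewrite predeqE => x; split=> -[Px h]; split=> // i; first by move=> _; exact: h.
by apply: h; rewrite mem_enum.
Qed.

Lemma vertices_face_of S : vertices (face_of S) = facet_closure A S.
Proof.
apply/setP => j; apply/idP/facet_closureP => [/mem_vertices h i iS | h].
  by apply/incP => x /h[_]; exact.
have [p [Pp p0 vj]] := vtx_minface j.
apply/mem_vertices; rewrite vj face_ge_minface //; last exact: face_face_of.
split=> // i /h /incP; rewrite vj face_ge_minface //; exact: face_fct.
Qed.

Lemma vertices_face_of_closed S : facet_closed A S -> vertices (face_of S) = S.
Proof. by rewrite vertices_face_of => /eqP. Qed.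

Lemma face_of_vertices F : face P F -> face_of (vertices F) = F.
Proof.
move=> fF; apply: face_eqP => //; first exact: face_face_of.
by rewrite vertices_face_of; apply/eqP/closed_vertices.
Qed.

Lemma face_rankE S : (face_rank S)%:Z = affdim (face_of S) + 1.
Proof.
by have [k e] := affdim_face_ge (face_face_of S); rewrite /face_rank e.
Qed.

Lemma vertices_set0 : vertices classical_sets.set0 = set0.
Proof.
apply/setP => j; rewrite [RHS]inE; apply/negP => /mem_vertices.
have [p [Pp _ ->]] := vtx_minface j; rewrite face_ge_minface //; exact: face_set0.
Qed.

Lemma closed_set0 : facet_closed A set0.
Proof. by rewrite -vertices_set0; exact/closed_vertices/face_set0. Qed.

Lemma face_of_set0 : face_of set0 = classical_sets.set0.
Proof. by rewrite -vertices_set0 face_of_vertices //; exact: face_set0. Qed.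

Lemma face_of_proper S T : facet_closed A S -> facet_closed A T ->
  S \proper T <-> (face_of S `<` face_of T)%classic.
Proof.
move=> cS cT; have fS := face_face_of S; have fT := face_face_of T.
rewrite -{1}(vertices_face_of_closed cS) -{1}(vertices_face_of_closed cT).
rewrite properE; split.
  move=> /andP[s /negP ns]; split; first exact: face_subsetP.
  by move=> /vertices_subset.
move=> [s ns]; rewrite vertices_subset //=; apply/negP => h.
by apply: ns; exact: face_subsetP.
Qed.

(** Gradedness is [exists_facet_face] within the face of T. If S is the empty face and T a vertex,
    the required face is the empty one. *)
Lemma rank_function_face_rank : rank_function A face_rank.
Proof.
split; first exact: closed_set0.
- by rewrite /face_rank face_of_set0 affdim_set0.
- move=> S T cS cT /(face_of_proper cS cT) lt; rewrite -ltz_nat !face_rankE.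
  by rewrite ltrD2r; apply: affdim_face_lt => //; exact: face_face_of.
move=> S T cS cT pST; have [s ns] := (face_of_proper cS cT).1 pST.
have fS := face_face_of S; have fT := face_face_of T.
suff [H [fH SH HT [z Tz nHz] dH]] : exists H, [/\ face P H,
    (face_of S `<=` H)%classic, (H `<=` face_of T)%classic,
    exists2 z, face_of T z & ~ H z & affdim H = affdim (face_of T) - 1].
  exists (vertices H); split; first exact: closed_vertices.
  - by rewrite -(vertices_face_of_closed cS); exact: vertices_subset.
  - apply/face_of_proper => //; first exact: closed_vertices.
    by rewrite face_of_vertices //; split=> // /(_ z Tz).
  - by apply/eqP; rewrite -eqz_nat -addn1 PoszD !face_rankE face_of_vertices // dH; lia.
have [z [Tz nSz]] : exists z, face_of T z /\ ~ face_of S z.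
  by apply: contrapT => no; apply: ns => z Tz; apply: contrapT => nz; apply: no; exists z.
case: (pselect (face_of S = classical_sets.set0)) => [S0 | nS0]; last first.
  have [|H [fH SH HT nHz dH]] := exists_facet_face fS fT s Tz nSz; first by right.
  by exists H; split=> //; exists z.
case: (face_cases fT) => [T0 | [y Py Ty]]; first by rewrite T0 in Tz.
have [k0 | kn] := eqVneq (kdim (active y)) 0%N.
  exists classical_sets.set0; rewrite S0 Ty affdim_set0 affdim_minface // k0.
  split=> //; [exact: face_set0 | by exists y => //; exact: minface_refl].
(* Below the empty face any point of the face of T may be the one to be missed; a generic y is
   missed by every vertex once the dimension is positive. *)
have [p [yp _ p0]] := vertex_below 0 bP Py.
have npy : ~ minface p y.
  by move=> [_ /(kdim_le M)]; rewrite p0 leqn0; exact/negP.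
have Ty' : face_of T y by rewrite Ty; exact: minface_refl.
have nSy : ~ face_of S y by rewrite S0.
have [|H [fH SH HT nHz dH]] := exists_facet_face fS fT s Ty' nSy.
  by left; exists p => //; rewrite Ty.
by exists H; split=> //; exists y.
Qed.

(** The first alternative covers the empty polytope and the single point, whose only facet is empty.
    In positive dimension facets are nonempty, and a vertex, being a proper face, lies in a
    facet. *)
Lemma small_or_incident :
  (m <= 1 /\ n <= 1)%N \/
  ((forall i, exists j, A i j) /\ (forall j, exists i, A i j)).
Proof.
case: (pselect (exists y, P y)) => [[y0 Py0] | no]; last first.
  left; have n0 : n = 0%N.
    case: (n) vtx vtx_minface => // n' v /(_ ord0) [p [Pp _ _]]; by case: no; exists p.
  (* A facet of the empty polytope would have dimension -2. *)
  have m0 : m = 0%N.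
    case: (m) fct fctP => // m' f /(_ (f ord0)) [_ []]; first by exists ord0.
    move=> /face_cases [->|[x Px _]]; last by case: no; exists x.
    rewrite (_ : P = classical_sets.set0) ?affdim_set0 // predeqE => x.
    by split=> // Px; case: no; exists x.
  by rewrite n0 m0.
have [y Py Py'] := nonempty_generic Py0.
have dP : affdim P = (kdim (active y))%:Z by rewrite {1}Py' affdim_minface.
have [k0 | kn] := eqVneq (kdim (active y)) 0%N.
  have Peq x : P x -> x = y.
    rewrite {1}Py' => /killed_sub; move/eqP: k0 => /(kdim0P M) h /h /eqP.
    by rewrite subr_eq0 => /eqP.
  have vE j j' : vtx j = vtx j'.
    have [p [/Peq -> _ ->]] := vtx_minface j.
    by have [p' [/Peq -> _ ->]] := vtx_minface j'.
  have fE i : fct i = classical_sets.set0.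
    have [_ dF] : facet P (fct i) by apply/fctP; exists i.
    case: (face_cases (face_fct i)) => // -[x Px e]; move: dF.
    by rewrite dP k0 e affdim_minface.
  left; split.
    case: (m) fct fct_inj fE => [|[|m']] // f fi e.
    by have := fi ord0 ord_max; rewrite !e => /(_ erefl).
  case: (n) vtx vtx_inj vE => [|[|n']] // v vi e.
  by have := vi ord0 ord_max (e _ _).
right; split=> [i | j].
  have [ff dF] : facet P (fct i) by apply/fctP; exists i.
  have [|j /mem_vertices/incP] := exists_vertex ff; last by exists j.
  by move=> F0; move: dF; rewrite F0 affdim_set0 dP; lia.
have [p [Pp p0 vj]] := vtx_minface j.
have npy : ~ minface p y.
  by move=> [_ /(kdim_le M)]; rewrite p0 leqn0; exact/negP.
have fp := face_minface Pp.
have pne : minface p <> classical_sets.set0.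
  by move=> e; have := minface_refl Pp; rewrite e.
have [|H [fH FH _ _ dH]] :=
  exists_facet_face fp face_setT (face_sub fp) Py npy; first by right.
have [i Hi] : exists i, H = fct i by apply/fctP.
by exists i; apply/incP; rewrite vj -Hi.
Qed.

Lemma skeleton_face_of k F :
  skeleton P k F <-> exists S, [/\ facet_closed A S, (face_rank S <= k.+1)%N & F = face_of S].
Proof.
split=> [[fF dF] | [S [cS rS ->]]].
  exists (vertices F); rewrite face_of_vertices //; split=> //.
    exact: closed_vertices.
  by rewrite -lez_nat face_rankE face_of_vertices //; lia.
by split; [exact: face_face_of | move: rS; rewrite -lez_nat face_rankE; lia].
Qed.

(** The list L exhibits the skeleton as a finite set, so [fset_set] does not take its default
    value. *)
Lemma num_faces_size k (L : seq {set 'I_n}) : uniq L ->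
  (forall S, S \in L <-> facet_closed A S /\ (face_rank S <= k.+1)%N) ->
  num_faces P k = size L.
Proof.
move=> uL LP; rewrite /num_faces.
have -> : fset_set (skeleton P k) = [fset face_of S | S in L]%fset.
  have e : skeleton P k = [set` [fset face_of S | S in L]%fset]%classic.
    rewrite predeqE => F; rewrite skeleton_face_of /=; split.
      move=> [S [cS rS ->]]; apply/imfsetP; exists S => //=; exact/LP.
    by move=> /imfsetP[S /= /LP[cS rS] ->]; exists S.
  by rewrite e set_fsetK.
rewrite card_in_imfset //= => [|S T].
  by rewrite undup_id.
move=> /LP[cS _] /LP[cT _] e.
by rewrite -(vertices_face_of_closed cS) e vertices_face_of_closed.
Qed.

Lemma hasse_diagram_of_closed_sets k (L : seq {set 'I_n}) arcs : uniq L ->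
  (forall S, S \in L <-> facet_closed A S /\ (face_rank S <= k.+1)%N) ->
  uniq arcs ->
  (forall i j, (i, j) \in arcs <-> [/\ (i < size L)%N, (j < size L)%N,
     nth set0 L i \proper nth set0 L j &
     face_rank (nth set0 L j) = (face_rank (nth set0 L i)).+1]) ->
  hasse_diagram P k (size L) arcs.
Proof.
move=> uL LP ua aP.
have cL (i : 'I_(size L)) : facet_closed A (nth set0 L i).
  by have /LP[] : nth set0 L i \in L by exact: mem_nth.
exists (fun i : 'I_(size L) => face_of (nth set0 L i)); split=> //.
- move=> i j e; apply/val_inj/eqP; rewrite -(nth_uniq set0 (ltn_ord i) (ltn_ord j) uL).
  by rewrite -(vertices_face_of_closed (cL i)) e vertices_face_of_closed.
- move=> F; rewrite skeleton_face_of; split.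
    move=> [S [cS rS ->]]; have SL : S \in L by apply/LP.
    have lt : (index S L < size L)%N by rewrite index_mem.
    by exists (Ordinal lt); rewrite /= nth_index.
  move=> [i ->]; exists (nth set0 L i).
  by have /LP[cS rS] : nth set0 L i \in L by exact: mem_nth.
- by move=> [i j] /aP[].
move=> i j; rewrite aP; split.
  move=> [_ _ pr e]; split; first by apply/(face_of_proper (cL i) (cL j)).
  by have := face_rankE (nth set0 L j); rewrite e -addn1 PoszD face_rankE; lia.
move=> [pr e]; split; [exact: ltn_ord | exact: ltn_ord | by apply/face_of_proper |].
by apply/eqP; rewrite -eqz_nat -addn1 PoszD !face_rankE e.
Qed.

End Incidence.

(** * Facets and vertices bounded by incidences, and the resulting algorithm *)

Lemma leq_num_incidences m n (A : 'M[bool]_(m, n)) :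
  (forall i, exists j, A i j) -> (forall j, exists i, A i j) ->
  m <= num_incidences A /\ n <= num_incidences A.
Proof.
move=> hm hn; split.
  rewrite -[X in X <= _]card_ord -cardsT; apply: leq_trans (leq_imset_card fst _).
  apply: subset_leq_card; apply/subsetP => i _; have [j Aij] := hm i.
  by apply/imsetP; exists (i, j); rewrite ?inE.
rewrite -[X in X <= _]card_ord -cardsT; apply: leq_trans (leq_imset_card snd _).
apply: subset_leq_card; apply/subsetP => j _; have [i Aij] := hn j.
by apply/imsetP; exists (i, j); rewrite ?inE.
Qed.

Theorem mainTheorem3 :
  exists (algorithm : prog) (C : nat),
    forall (R : realType) (d : nat) (P : set 'cV[R]_d)
           (m n : nat) (A : 'M[bool]_(m, n)) (k : nat),
      polytope P -> incidence_matrix P A ->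
      exists (t : nat) (s : state),
        exec algorithm (input A k) t s /\
        hasse_diagram P k (output_nodes s) (output_arcs s) /\
        t <= C * maxn 1 (n * num_incidences A * num_faces P k).
Proof.
exists skeleton_prog, 3000 => R d P m n A k [[q [M [b PE]]] bP].
have {PE} PE : P = inP M b by [].
rewrite PE in bP *; move=> [fct [vtx [fct_inj fctP vtx_inj vtxP incP]]].
have rP := rank_function_face_rank bP fctP vtxP incP.
have [t [s [ex le [L [Ar [sL sAr xL]]]]]] := skeleton_prog_runs k rP.
have LP := explored_complete rP xL.
have uL := explored_uniq xL.
exists t, s; rewrite sL sAr; split=> //; split.
  apply: (hasse_diagram_of_closed_sets bP fctP vtxP incP uL LP).
    exact: explored_uniq_arcs xL.
  move=> i j; rewrite (explored_arcs xL); split.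
    by move=> [li lj /and3P[_ p /eqP e] _].
  move=> [li lj p e]; split=> //; last by rewrite /treated li.
  by have /LP[cj _] := mem_nth finset.set0 lj; rewrite /covers cj p e eqxx.
(* The completed list enumerates both the faces and the closed sets of rank at most k + 1. *)
have -> : num_faces (inP M b) k = num_closed A (face_rank M b A fct) k.
  rewrite (num_faces_size bP fctP vtxP incP uL LP) -(card_uniqP uL).
  apply: eq_card => S; rewrite inE; apply/idP/andP => [/LP // | ?]; exact/LP.
apply: leq_trans le _; case: (small_or_incident bP fct_inj fctP vtx_inj vtxP incP).
  move=> [m1 n1]; apply: leq_trans (total_time_small A _ k m1 n1) _.
  by rewrite leq_pmulr // leq_max.
move=> [hm hn]; have [ma na] := leq_num_incidences hm hn.
(* Without vertices there is no facet either, as each facet has a vertex; the time is then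
   constant. *)
case: (posnP n) => [n0 | n_gt0].
  apply: leq_trans (total_time_small A _ k _ _) _; last by rewrite leq_pmulr // leq_max.
    by case: (posnP m) => [-> // | m0]; have [[j jn] _] := hm (Ordinal m0); rewrite n0 in jn.
  by rewrite n0.
rewrite -size_incidences in ma na *.
apply: leq_trans (total_time_large k rP n_gt0 ma na) _.
by rewrite leq_mul2l leq_max leqnn !orbT.
Qed.
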